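(* Let $\lambda\in\mathbb{R}$, $r_0>0$, and let $n\ge 2$ be an integer. Consider the inequality $$-\Delta^2 v\ge v^\lambda\quad\text{in } \mathbb{R}^n\setminus B_{r_0}(0).$$ (i) If $n=2$, then this inequality has a $C^4$ positive solution $v$ in $\mathbb{R}^2\setminus B_{r_0}(0)$ if and only if $\lambda<-1$. (ii) If $n\ge 3$, then this inequality has a $C^4$ positive solution $v$ in $\mathbb{R}^n\setminus B_{r_0}(0)$ if and only if $\lambda<-1$ or $\lambda>1+\frac{4}{n-2}$.
   Context: $\Delta^2=\Delta\circ\Delta$ is the biharmonic operator and $B_{r}(0)$ is the open ball of radius $r$ centered at the origin in $\mathbb{R}^n$. A $C^4$ positive solution is a $C^4$ function $v>0$ satisfying the inequality pointwise. *)

(* Defs.v *)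
From mathcomp Require Import all_boot all_order all_algebra.
From mathcomp Require Import all_classical all_reals all_analysis.

Set Implicit Arguments.
Unset Strict Implicit.
Unset Printing Implicit Defensive.

Import Order.TTheory GRing.Theory Num.Theory.
Import numFieldNormedType.Exports.

Local Open Scope classical_set_scope.
Local Open Scope ring_scope.

(* The library norm on ['rV[R]_n] is the sup norm, so the Euclidean norm is
   defined separately; both induce the same topology. *)
Definition enorm (R : realType) (n : nat) (x : 'rV[R]_n) : R :=
  Num.sqrt (\sum_(i < n) x ord0 i ^+ 2).

Definition eball0 (R : realType) (n : nat) (r : R) : set 'rV[R]_n :=
  [set x | enorm x < r].

Definition partial (R : realType) (n : nat) (i : 'I_n) (f : 'rV[R]_n -> R) :
    'rV[R]_n -> R :=
  fun x => 'D_(delta_mx ord0 i) f x.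

Definition laplacian (R : realType) (n : nat) (f : 'rV[R]_n -> R) :
    'rV[R]_n -> R :=
  fun x => \sum_(i < n) partial i (partial i f) x.

Definition bilaplacian (R : realType) (n : nat) (f : 'rV[R]_n -> R) :
    'rV[R]_n -> R :=
  laplacian (laplacian f).

(* [Ck_open k U f], for [U] open: all iterated partial derivatives of [f] of
   order at most [k] exist and are continuous at every point of [U]. *)
Fixpoint Ck_open (R : realType) (n k : nat) (U : set 'rV[R]_n)
    (f : 'rV[R]_n -> R) : Prop :=
  (forall x, U x -> {for x, continuous f}) /\
  match k with
  | 0 => True
  | k'.+1 => forall i : 'I_n,
      (forall x, U x -> derivable f x (delta_mx ord0 i)) /\
      Ck_open k' U (partial i f)
  end.

(* [C^k] on an arbitrary set [A] means [C^k] on some open neighbourhood of [A].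
   A total function [f] stands for its extension to that neighbourhood; when
   [A] is the closure of its interior, the partial derivatives of [f] at points
   of [A] do not depend on the choice of the extension. *)
Definition Ck_on (R : realType) (n k : nat) (A : set 'rV[R]_n)
    (f : 'rV[R]_n -> R) : Prop :=
  exists U : set 'rV[R]_n, [/\ open U, A `<=` U & Ck_open k U f].

Definition C4_positive_solution (R : realType) (n : nat) (lambda : R)
    (A : set 'rV[R]_n) (v : 'rV[R]_n -> R) : Prop :=
  [/\ Ck_on 4 A v,
      forall x, A x -> 0 < v x &
      forall x, A x -> - bilaplacian v x >= v x `^ lambda].

(* Main.v *)
(* Let v be a positive solution, and average v, - Delta v and - Delta^2 v over
   spheres of radius r about the origin, or rather over smooth shells of radius
   comparable to r, to get V, U and H. Then - Delta V = U, Delta U = H and H >= 0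
   in the radial sense, and positivity of V forces r U' + (n - 2) U <= 0, whence
   V <= C r^2 ln r and the integral of r H is bounded.  Since Delta^2 v <= 0
   and v > 0, one has v(x) <= (4/3) M_r v(x) for the spherical means M_r about x,
   because (M_r v(x) - v(x)) / r^2 decreases in r; so v itself is at most
   C |x|^2 ln |x|.  Writing v^lambda = v^q v^(lambda - q) with q = 0 or q >= 1 and
   using Jensen's inequality for v^q gives H >= c (r^2 ln r)^(lambda - q) V^q for
   every such q >= lambda.  For lambda >= -1, either V stays bounded below, and
   then r H is not integrable, or U >= 0 and V decays; in that case
   P = - r^(n-1) V' satisfies a differential inequality dP/d(ln r) >= c P^q with
   some q > 1 as long as lambda <= 1 + 4/(n-2), so it blows up at a finite radius.
   Conversely, suitable multiples of powers of |x| are solutions, to which a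
   biharmonic multiple of |x|^2 must be added when n = 2. *)
Require Import Defs.
From mathcomp Require Import all_boot all_order all_algebra.
From mathcomp Require Import all_classical all_reals all_analysis.
From mathcomp Require Import ring lra.

Import Order.TTheory GRing.Theory Num.Theory.
Import numFieldNormedType.Exports.

Local Open Scope classical_set_scope.
Local Open Scope ring_scope.

Set Implicit Arguments.
Unset Strict Implicit.
Unset Printing Implicit Defensive.

(** * One-variable calculus *)

(** The two thresholds come from two borderline rates. With [q = 0] the bound reads H >= c (r^2 ln
    r)^lam; at lam = -1 the integrand r H is of order 1 / (r ln r), which still diverges, so the
    logarithm in the growth bound is harmless. In the decaying case U dominates r^2 H and V
    dominates r^(2 - n) P, so dP/d(ln r) = r^n U carries the factor r^(n + 2 - (n - 2) q), and for q
    = lam this does not decay precisely when lam <= 1 + 4 / (n - 2). The exponent [q] is kept apart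
    from [lam] because Jensen needs a convex power and blow-up needs q > 1. The price is the
    negative power v^(lam - q), which is bounded below only by a pointwise upper bound on [v]; a
    bound on its means would not do. Averages are taken of f (x + t y) against a weight p (|y|^2)
    with [y] in a fixed cube, so that differentiation in [t] and integration by parts in [y] replace
    surface measure. Each Laplacian multiplies the weight by |y|^2: V, U and H thus carry the
    weights p, s p and s^2 p with s = |y|^2, and s >= 1 on the shell suffices to compare them. *)

Section OneVariable.
Context {R : realType}.
Implicit Types (f g : R -> R) (x a b c m : R).

Lemma is_derive_within_continuous f f' a b :
  (forall x, a <= x <= b -> is_derive x 1 f (f' x)) ->
  {within `[a, b], continuous f}.
Proof.
move=> df; apply: continuous_in_subspaceT => x; rewrite inE/= in_itv/= => xab.
have [fx _] := df x xab.
exact/differentiable_continuous/derivable1_diffP.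
Qed.

Lemma MVT_le f f' a b : a <= b ->
  (forall x, a <= x <= b -> is_derive x 1 f (f' x)) ->
  exists2 c, a <= c <= b & f b - f a = f' c * (b - a).
Proof.
move=> ab df.
have [c cab fc] := MVT_segment ab
  (fun x xab => df x (subset_itv_oo_cc xab)) (is_derive_within_continuous df).
by exists c; first by move: cab; rewrite in_itv.
Qed.

Lemma is_derive_ge0_le f f' a b : a <= b ->
  (forall x, a <= x <= b -> is_derive x 1 f (f' x)) ->
  (forall x, a <= x <= b -> 0 <= f' x) -> f a <= f b.
Proof.
move=> ab df f'0; have [c cab fc] := MVT_le ab df.
by rewrite -subr_ge0 fc mulr_ge0 ?f'0// subr_ge0.
Qed.

Lemma is_derive_le0_le f f' a b : a <= b ->
  (forall x, a <= x <= b -> is_derive x 1 f (f' x)) ->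
  (forall x, a <= x <= b -> f' x <= 0) -> f b <= f a.
Proof.
move=> ab df f'0; have [c cab fc] := MVT_le ab df.
by rewrite -subr_le0 fc mulr_le0_ge0 ?f'0// subr_ge0.
Qed.

Lemma is_derive_pinfty f f' a c : 0 < c ->
  (forall x, a <= x -> is_derive x 1 f (f' x)) ->
  (forall x, a <= x -> c <= f' x) ->
  forall M, exists2 b, a <= b & forall x, b <= x -> M <= f x.
Proof.
move=> c0 df f'c M; exists (a + `|M - f a| / c).
  by rewrite lerDl divr_ge0// ltW.
move=> x bx; have ax : a <= x by apply: le_trans bx; rewrite lerDl divr_ge0// ltW.
have [y /andP[ay yx] fxa] := MVT_le ax (fun z zax => df z (proj1 (andP zax))).
have : `|M - f a| <= f' y * (x - a).
  rewrite (@le_trans _ _ (c * (x - a)))// ?ler_wpM2r ?f'c ?subr_ge0//.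
  by rewrite mulrC -ler_pdivrMr// lerBrDl.
rewrite -fxa => MB; have := ler_norm (M - f a); lra.
Qed.

Lemma is_derive_ninfty f f' a c : 0 < c ->
  (forall x, a <= x -> is_derive x 1 f (f' x)) ->
  (forall x, a <= x -> f' x <= - c) ->
  forall M, exists2 b, a <= b & forall x, b <= x -> f x <= M.
Proof.
move=> c0 df f'c M.
have [|x ax|b ab fb] := @is_derive_pinfty (fun x => - f x) (fun x => - f' x) a c c0 _ _ (- M).
- by move=> x ax; exact: is_deriveN (df x ax).
- by rewrite lerNr f'c.
- by exists b => // x bx; rewrite -lerN2 fb.
Qed.

End OneVariable.

Section PointwiseDerivatives.
Context {R : realType} {V : normedModType R}.
Implicit Types (f g : V -> R) (x v : V) (c df dg : R).

Lemma is_derive_add f g x v df dg : is_derive x v f df -> is_derive x v g dg ->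
  is_derive x v (fun y => f y + g y) (df + dg).
Proof. exact: is_deriveD. Qed.

Lemma is_derive_opp f x v df : is_derive x v f df ->
  is_derive x v (fun y => - f y) (- df).
Proof. exact: is_deriveN. Qed.

Lemma is_derive_mul f g x v df dg : is_derive x v f df -> is_derive x v g dg ->
  is_derive x v (fun y => f y * g y) (df * g x + f x * dg).
Proof.
move=> fx gx; have -> : df * g x + f x * dg = f x *: dg + g x *: df.
  by rewrite addrC [df * _]mulrC.
exact: is_deriveM.
Qed.

Lemma is_derive_const c x v : is_derive x v (fun=> c) 0.
Proof. exact: is_derive_cst. Qed.

Lemma is_derive_sumr n (h : 'I_n -> V -> R) (dh : 'I_n -> R) x v :
  (forall i, is_derive x v (h i) (dh i)) ->
  is_derive x v (fun y => \sum_(i < n) h i y) (\sum_(i < n) dh i).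
Proof.
move=> hx; have := is_derive_sum hx.
suff -> : \sum_(i < n) h i = fun y => \sum_(i < n) h i y by [].
by apply/funext => y; rewrite fct_sumE.
Qed.

End PointwiseDerivatives.

Section Composite.
Context {R : realType}.
Implicit Types (f g : R -> R) (x a b : R).

Lemma is_derive1_chain f g x a b : is_derive (g x) 1 f a -> is_derive x 1 g b ->
  is_derive x 1 (fun y => f (g y)) (a * b).
Proof. exact: is_derive1_comp. Qed.

Lemma is_derive_var x : is_derive x 1 (fun y => y) 1.
Proof. exact: is_derive_id. Qed.

Lemma is_derive_expRZ (m x : R) :
  is_derive x 1 (fun y => expR (m * y)) (m * expR (m * x)).
Proof.
apply: is_derive_eq (is_derive1_chain (is_derive_expR _)
  (is_derive_mul (is_derive_const m x 1) (is_derive_var x))) _.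
by rewrite mul0r add0r mulr1 mulrC.
Qed.

End Composite.

Section PowersAndGrowth.
Context {R : realType}.

(** P^(1 - q) stays positive, yet its derivative (1 - q) P^(-q) P' is at most -(q - 1) c, which
    would drive it to 0 in finite time. *)
Lemma superlinear_growth_absurd (P P' : R -> R) (a c q : R) : 0 < c -> 1 < q ->
  (forall t, a <= t -> is_derive t 1 P (P' t)) ->
  (forall t, a <= t -> 0 < P t) ->
  ~ (forall t, a <= t -> c * P t `^ q <= P' t).
Proof.
move=> c0 q1 dP P0 P'q.
have [|t at_|t at_|b ab fb] := @is_derive_ninfty _ (fun t => P t `^ (1 - q))
   (fun t => (1 - q) * P t `^ (1 - q - 1) * P' t) a ((q - 1) * c) _ _ _ 0.
- by rewrite mulr_gt0// subr_gt0.
- exact: (is_derive1_chain (f := fun x => x `^ (1 - q)) (is_derive1_powR _ (P0 t at_)) (dP t at_)).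
- have -> : 1 - q - 1 = - q by ring.
  have Pq : 0 < P t `^ q by rewrite powR_gt0// P0.
  rewrite powRN -mulrA -mulNr opprB ler_wnM2l//; first lra.
  by rewrite mulrC ler_pdivlMr// P'q.
- by have := fb b (lexx b); rewrite leNgt powR_gt0// P0.
Qed.

Lemma le0_ler_powR (x y r : R) : r <= 0 -> 0 < x -> x <= y -> y `^ r <= x `^ r.
Proof.
move=> r0 x0 xy; rewrite -(opprK r) !(powRN _ (- r)).
rewrite lef_pV2 ?posrE ?powR_gt0 ?(lt_le_trans x0)//.
by rewrite ge0_ler_powR ?nnegrE ?oppr_ge0// ltW// (lt_le_trans x0).
Qed.

End PowersAndGrowth.

(* [is_derive] is a type class: plain [refine] would let instance search solve
   the goals with derivatives in [*:] form. *)
Ltac derive_pointwise :=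
  notypeclasses refine (is_derive_eq _ _);
  [ repeat first
    [ notypeclasses refine (is_derive_const _ _ _)
    | notypeclasses refine (is_derive_var _)
    | notypeclasses refine (is_derive_expRZ _ _)
    | notypeclasses refine (is_derive_opp _)
    | notypeclasses refine (is_derive_add _ _)
    | notypeclasses refine (is_derive_mul _ _) ]
  | cbv beta ].

(** * The radial system *)

(* In dimension [m + 2] and with [r = expR t], [V] and [U] stand for the averages
   of [v] and [- Delta v] over spheres of radius [r], and [H] for that of
   [- Delta^2 v]. *)
Section RadialSystem.
Context {R : realType}.
Variables (m T : R) (V X U Y H : R -> R).
Hypotheses (m0 : 0 <= m) (T1 : 1 <= T).
Hypothesis V' : forall t, T <= t -> is_derive t 1 V (X t).
Hypothesis X' : forall t, T <= t ->
  is_derive t 1 X (- m * X t - expR (2 * t) * U t).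
Hypothesis U' : forall t, T <= t -> is_derive t 1 U (Y t).
Hypothesis Y' : forall t, T <= t ->
  is_derive t 1 Y (- m * Y t + expR (2 * t) * H t).
Hypotheses (Vgt0 : forall t, T <= t -> 0 < V t)
  (Hge0 : forall t, T <= t -> 0 <= H t).

(* [lra] does not see section hypotheses. *)
Local Ltac lra' := have := m0; have := T1; lra.
Local Ltac nra' := have := m0; have := T1; nra.

Let expmt (f : R -> R) (f' t : R) : is_derive t 1 f f' ->
  is_derive t 1 (fun t => expR (m * t) * f t) (expR (m * t) * (m * f t + f')).
Proof.
move=> ff'; derive_pointwise; [exact: ff'|ring].
Qed.

Let expmt_ge1 t : T <= t -> 1 <= expR (m * t).
Proof. move=> Tt; rewrite -[leLHS]expR0 ler_expR mulr_ge0//. lra'. Qed.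

(** The derivative of expR (m t) f is expR (m t) (m f + f') >= c, since expR (m t) >= 1; this treats
    [m = 0] and [m > 0] at once. *)
Let ge0_eventually (f f' : R -> R) (a c : R) : T <= a -> 0 < c ->
  (forall t, a <= t -> is_derive t 1 f (f' t)) ->
  (forall t, a <= t -> c <= m * f t + f' t) ->
  exists2 b, a <= b & forall t, b <= t -> 0 <= f t.
Proof.
move=> Ta c0 df f'c.
have [t at_|b ab fb] := @is_derive_pinfty _ (fun t => expR (m * t) * f t) _ a c c0
   (fun t at_ => expmt (df t at_)) _ 0.
- apply: le_trans (f'c t at_) _; rewrite ler_peMl ?expmt_ge1 ?(le_trans Ta)//.
  exact: le_trans (ltW c0) (f'c t at_).
- by exists b => // t /fb; rewrite pmulr_rge0// expR_gt0.
Qed.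

Let K (t : R) := Y t + m * U t.

Let K' t : T <= t -> is_derive t 1 K (expR (2 * t) * H t).
Proof.
move=> Tt; derive_pointwise; [exact: Y'|exact: U'|ring].
Qed.

Let K_nondecr a b : T <= a -> a <= b -> K a <= K b.
Proof.
move=> Ta ab; apply: (is_derive_ge0_le ab (fun t tab => K' _)) => t /andP[at_ _].
  exact: le_trans at_.
by rewrite mulr_ge0 ?expR_ge0 ?Hge0// (le_trans Ta).
Qed.

Let V_not_ninfty (a c : R) : T <= a -> 0 < c -> ~ (forall t, a <= t -> X t <= - c).
Proof.
move=> Ta c0 Xc.
have [b ab Vb] := is_derive_ninfty c0 (fun t (at_ : a <= t) => V' (le_trans Ta at_)) Xc 0.
by have := Vgt0 (le_trans Ta ab); rewrite ltNge Vb.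
Qed.

(* If [K a = k > 0], then [U] is eventually bounded below by a positive
   constant, which makes [V] tend to minus infinity. *)
Lemma radial_K_le0 t : T <= t -> Y t + m * U t <= 0.
Proof.
move=> Tt; rewrite leNgt; apply/negP => Kt0.
(* Chosen so that m e <= k / 2, whence m (U - e) + Y >= k / 2; the [+ 1] keeps [e] meaningful for
   [m = 0]. *)
pose k := K t; pose e := k / (2 * (m + 1)).
have k0 : 0 < k by [].
have e0 : 0 < e by rewrite divr_gt0//; lra'.
have me : m * e <= k / 2.
  have -> : m * e = (k / 2) * (m / (m + 1)) by rewrite /e; field; lra'.
  rewrite ler_piMr//; first lra'.
  by rewrite ler_pdivrMr; lra'.
have [||s ts|b tb Ub] := @ge0_eventually (fun t => U t - e) Y t (k / 2) Tt.
- lra'.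
- move=> s ts; derive_pointwise; [apply: U'; lra'|ring].
- have := K_nondecr Tt ts; rewrite -/k /K; lra'.
(* From [c] on, expR (2 s) U s >= s e >= m + 1, which eventually forces X + 1 <= 0. *)
pose c := Num.max b ((m + 1) / e).
have bc : b <= c by rewrite le_max lexx.
have [||s cs|d cd Xd] := @ge0_eventually (fun t => - (X t + 1))
   (fun t => m * X t + expR (2 * t) * U t) c 1 _ ltr01.
- lra'.
- move=> s cs; derive_pointwise; [apply: X'; lra'|ring].
- have /Ub Ue : b <= s by lra'.
  have ms : m + 1 <= s * e.
    rewrite -ler_pdivrMr//; by apply: le_trans cs; rewrite le_max lexx orbT.
  have es : s <= expR (2 * s) by have := expR_ge1Dx (2 * s); lra'.
  have : s * e <= expR (2 * s) * U s by apply: ler_pM; lra'.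
  lra'.
apply: (@V_not_ninfty d 1) => //; first lra'.
by move=> s /Xd; lra'.
Qed.

(** [K] is nondecreasing, so it stays above -k with k = |K T|, and this makes expR (m t) (U + k t)
    nondecreasing. The linear term is a logarithm of the radius; it allows for the plane, where
    [m = 0]. *)
Lemma radial_U_ge : exists2 C : R, 0 < C & forall t, T <= t -> - C * t <= U t.
Proof.
pose k := `|K T|; have k0 : 0 <= k by exact: normr_ge0.
pose c := expR (m * T) * `|U T + k * T|.
exists (k + c + 1); first by rewrite ltr_wpDl ?addr_ge0 ?mulr_ge0 ?expR_ge0.
move=> t Tt.
have h : expR (m * T) * (U T + k * T) <= expR (m * t) * (U t + k * t).
  apply: (@is_derive_ge0_le _ (fun t => expR (m * t) * (U t + k * t))
     (fun t => expR (m * t) * (m * (U t + k * t) + (Y t + k)))) => // s /andP[Ts _].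
    apply: expmt; derive_pointwise; [exact: U'|ring].
  apply: mulr_ge0; first exact: expR_ge0.
  have : - k <= K s by apply: le_trans (K_nondecr (lexx T) Ts); exact: lerNnormlW.
  rewrite /K; have : 0 <= m * (k * s) by rewrite !mulr_ge0//; lra'.
  lra'.
have h1 : - c <= expR (m * t) * (U t + k * t).
  apply: le_trans h; rewrite -mulrN ler_wpM2l ?expR_ge0//.
  by rewrite lerNl -normrN ler_norm.
have c0 : 0 <= c by rewrite mulr_ge0// expR_ge0.
have e1 := expmt_ge1 Tt.
have : - c <= U t + k * t.
  have [h0|h0] := leP 0 (U t + k * t); first lra'.
  nra'.
have : c <= c * t by rewrite ler_peMr//; lra'.
lra'.
Qed.

(** Two integrations of U >= - C ln r. With z = t expR (2 t), that is r^2 ln r, the function expR (m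
    t) (X - C z) is nonincreasing; this bounds X by (C + c) z, and then V - (C + c) z is
    nonincreasing. *)
Lemma radial_V_le : exists2 C : R, 0 < C &
  forall t, T <= t -> V t <= C * (t * expR (2 * t)).
Proof.
have [C C0 UC] := radial_U_ge.
have dX0 t (c : R) : T <= t -> is_derive t 1 (fun t => X t - c * (t * expR (2 * t)))
    (- m * X t - expR (2 * t) * U t - c * (expR (2 * t) + 2 * t * expR (2 * t))).
  move=> Tt; derive_pointwise; [exact: X'|ring].
pose c := expR (m * T) * `|X T - C * (T * expR (2 * T))|.
have c0 : 0 <= c by rewrite mulr_ge0// expR_ge0.
have te t : T <= t -> 1 <= t * expR (2 * t).
  by move=> Tt; have := expR_ge1Dx (2 * t); nra'.
have Xle t : T <= t -> X t <= (C + c) * (t * expR (2 * t)).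
  move=> Tt.
  have h : expR (m * t) * (X t - C * (t * expR (2 * t))) <=
           expR (m * T) * (X T - C * (T * expR (2 * T))).
    apply: (is_derive_le0_le Tt (fun s sTt => expmt (dX0 s C (proj1 (andP sTt))))).
    move=> s /andP[Ts st]; apply: mulr_ge0_le0; first exact: expR_ge0.
    have e0 : 0 <= expR (2 * s) by exact: expR_ge0.
    have : - C * s * expR (2 * s) <= U s * expR (2 * s) by rewrite ler_wpM2r ?UC.
    have : 0 <= m * C * s * expR (2 * s) by rewrite !mulr_ge0//; lra'.
    have : 0 <= C * expR (2 * s) by rewrite mulr_ge0// ltW.
    have : 0 <= C * s * expR (2 * s) by rewrite !mulr_ge0//; lra'.
    lra'.
  have {}h : expR (m * t) * (X t - C * (t * expR (2 * t))) <= c.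
    by apply: le_trans h _; rewrite ler_wpM2l ?expR_ge0// ler_norm.
  have e1 := expmt_ge1 Tt.
  have Xc : X t - C * (t * expR (2 * t)) <= c.
    have [h0|h0] := leP (X t - C * (t * expR (2 * t))) 0; first lra'.
    by apply: le_trans h; rewrite ler_peMl// ltW.
  have : c <= c * (t * expR (2 * t)) by rewrite ler_peMr// te.
  lra'.
pose D := `|V T - (C + c) * (T * expR (2 * T))|.
have D0 : 0 <= D by exact: normr_ge0.
exists (C + c + D); first lra'.
move=> t Tt.
have h : V t - (C + c) * (t * expR (2 * t)) <= V T - (C + c) * (T * expR (2 * T)).
  apply: (@is_derive_le0_le _ (fun t => V t - (C + c) * (t * expR (2 * t)))
    (fun t => X t - (C + c) * (expR (2 * t) + 2 * t * expR (2 * t)))) => //.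
    move=> s /andP[Ts _]; derive_pointwise; [exact: V'|ring].
  move=> s /andP[Ts _]; have := Xle s Ts.
  have : 0 <= (C + c) * (s * expR (2 * s)) by rewrite !mulr_ge0 ?expR_ge0//; lra'.
  have : 0 <= (C + c) * expR (2 * s) by rewrite mulr_ge0 ?expR_ge0//; lra'.
  lra'.
have := ler_norm (V T - (C + c) * (T * expR (2 * T))); rewrite -/D.
have := te t Tt; nra'.
Qed.

(** K' = expR (2 t) H would be at least c / t. Composing with the exponential absorbs the 1 / t: the
    function K (expR t) has derivative at least [c], so [K] becomes positive, against
    [radial_K_le0]. *)
Lemma radial_H_not_large c : 0 < c -> forall a, T <= a ->
  ~ (forall t, a <= t -> c / (t * expR (2 * t)) <= H t).
Proof.
move=> c0 a Ta Hc.
pose f := fun t => K (expR t).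
have [t at_|t at_|b ab fb] := @is_derive_pinfty _ f
    (fun t => expR (2 * expR t) * H (expR t) * expR t) a c c0 _ _ 1.
- have Tt : a <= expR t by have := expR_ge1Dx t; lra'.
  have Te : T <= expR t by lra'.
  exact: (is_derive1_chain (K' Te) (is_derive_expR t)).
- have ate : a <= expR t by have := expR_ge1Dx t; lra'.
  have := Hc _ ate.
  rewrite ler_pdivrMr; last by rewrite mulr_gt0 ?expR_gt0.
  lra'.
- have : T <= expR b by have := expR_ge1Dx b; lra'.
  by move/radial_K_le0; have := fb b (lexx b); rewrite /f/K; lra'.
Qed.


(* If [U < 0] somewhere then [X > 0] eventually; if [U >= 0] then
   [m V + X >= 0], as otherwise [V] would tend to minus infinity. *)
Lemma radial_dichotomy :
  (exists2 c : R, 0 < c & exists2 a : R, T <= a & forall t, a <= t -> c <= V t) \/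
  exists2 a : R, T <= a & forall t, a <= t ->
    [/\ 0 <= U t, X t < 0 & 0 <= m * V t + X t].
Proof.
have V_ge a : T <= a -> (forall t, a <= t -> 0 <= X t) ->
    exists2 c : R, 0 < c & exists2 a : R, T <= a & forall t, a <= t -> c <= V t.
  move=> Ta X0; exists (V a); first exact: Vgt0.
  exists a => // t at_.
  by apply: (is_derive_ge0_le at_ (fun s sat => V' (le_trans Ta (proj1 (andP sat)))))
    => s /andP[as_ _]; exact: X0.
have [[a Ta Ua]|U0] := pselect (exists2 a : R, T <= a & U a < 0).
  left; pose c := - (expR (m * a) * U a).
  have c0 : 0 < c by rewrite oppr_gt0 pmulr_rlt0// expR_gt0.
  have Uc t : a <= t -> c <= expR (m * t) * - U t.
    move=> at_; rewrite /c mulrN lerN2.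
    apply: (is_derive_le0_le at_ (fun s sat => expmt (U' (le_trans Ta (proj1 (andP sat)))))).
    move=> s /andP[as_ _]; apply: mulr_ge0_le0; first exact: expR_ge0.
    by have := radial_K_le0 (le_trans Ta as_); lra'.
  have [|t at_|b ab Xb] := @is_derive_pinfty _ (fun t => expR (m * t) * X t)
      (fun t => expR (m * t) * (m * X t + (- m * X t - expR (2 * t) * U t))) a c c0 _ _ 0.
  - by move=> t at_; apply: expmt; exact: X' (le_trans Ta at_).
  - have -> : expR (m * t) * (m * X t + (- m * X t - expR (2 * t) * U t)) =
              expR (2 * t) * (expR (m * t) * - U t) by ring.
    have := Uc t at_; have : 1 <= expR (2 * t).
      by rewrite -[leLHS]expR0 ler_expR; have := le_trans Ta at_; lra'.
    nra'.
  - apply: (@V_ge b); first lra'.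
    by move=> t /Xb; rewrite pmulr_rge0// expR_gt0.
have {}U0 t : T <= t -> 0 <= U t.
  by move=> Tt; rewrite leNgt; apply/negP => Ut; apply: U0; exists t.
have mVX a t : T <= a -> a <= t -> m * V t + X t <= m * V a + X a.
  move=> Ta at_; apply: (@is_derive_le0_le _ (fun t => m * V t + X t)
     (fun t => - (expR (2 * t) * U t))) => // s /andP[as_ _].
    derive_pointwise; [apply: V'; lra'|apply: X'; lra'|ring].
  by rewrite oppr_le0 mulr_ge0 ?expR_ge0// U0; lra'.
have {}mVX t : T <= t -> 0 <= m * V t + X t.
  move=> Tt; rewrite leNgt; apply/negP => Xt.
  apply: (@V_not_ninfty t (- (m * V t + X t))) => //; first lra'.
  move=> s ts; have := mVX t s Tt ts.
  have : 0 <= m * V s by rewrite mulr_ge0// ltW// Vgt0; lra'.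
  lra'.
have [[a Ta Xa]|X0] := pselect (exists2 a : R, T <= a & X a < 0); last first.
  left; apply: (@V_ge T) => // t Tt.
  by rewrite leNgt; apply/negP => Xt; apply: X0; exists t.
right; exists a => // t at_; split; [apply: U0; lra'| |apply: mVX; lra'].
have : expR (m * t) * X t <= expR (m * a) * X a.
  apply: (is_derive_le0_le at_ (fun s sat => expmt (X' (le_trans Ta (proj1 (andP sat)))))).
  move=> s /andP[as_ _]; apply: mulr_ge0_le0; first exact: expR_ge0.
  have : 0 <= expR (2 * s) * U s by rewrite mulr_ge0 ?expR_ge0// U0; lra'.
  lra'.
move=> h; rewrite -(pmulr_rlt0 _ (expR_gt0 (m * t))); apply: le_lt_trans h _.
by rewrite pmulr_rlt0// expR_gt0.
Qed.

(** * Contradiction from power lower bounds on [H] *)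

Variable lam : R.
Hypotheses (lamN1 : -1 <= lam) (mlam : m * lam <= m + 4).
Hypothesis HV : forall q, lam <= q -> q = 0 \/ 1 <= q ->
  exists2 c : R, 0 < c & exists2 a : R, T <= a & forall t, a <= t ->
    c * (t * expR (2 * t)) `^ (lam - q) * V t `^ q <= H t.

Let z (t : R) := t * expR (2 * t).

Let z_ge1 t : T <= t -> 1 <= z t.
Proof.
move=> Tt; have := expR_ge1Dx (2 * t); rewrite /z => h.
by rewrite -[leLHS]mulr1 ler_pM//; lra'.
Qed.

(** As q <= lam + 1 and z >= 1, the factor z^(lam - q) is at least 1 / z, so [H] reaches the
    borderline rate excluded by [radial_H_not_large]. For [q = 0] the condition q <= lam + 1 is
    exactly lam >= -1. *)
Let V_ge_absurd (q c a : R) : 0 <= q -> lam <= q <= lam + 1 -> q = 0 \/ 1 <= q ->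
  0 < c -> T <= a -> ~ (forall t, a <= t -> c <= V t `^ q).
Proof.
move=> q0 /andP[lq ql] q01 c0 Ta Vc; have [d d0 [b Tb Hd]] := HV lq q01.
apply: (@radial_H_not_large (d * c) _ (Num.max a b)) => [||t].
- exact: mulr_gt0.
- by rewrite le_max Ta.
rewrite ge_max => /andP[at_ bt]; apply: le_trans (Hd t bt).
have zt := z_ge1 (le_trans Ta at_).
have z0 : 0 <= z t by lra.
have zi : (z t)^-1 <= z t `^ (lam - q) by rewrite -powR_inv1// ler_powR//; lra.
rewrite -/(z t) mulrAC ler_pM ?mulr_ge0 ?invr_ge0 ?ler_pM2l ?Vc ?(ltW d0) ?(ltW c0)//.
Qed.

Section Decaying.
Variables (q c a : R).
Hypotheses (lamq : lam <= q) (q0 : 0 <= q) (c0 : 0 < c) (Ta : T <= a).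
Hypothesis Hq : forall t, a <= t -> c * z t `^ (lam - q) * V t `^ q <= H t.
Hypothesis UXV : forall t, a <= t -> [/\ 0 <= U t, X t < 0 & 0 <= m * V t + X t].

Let G (t : R) := c * z t `^ (lam - q) * V t `^ q.
(** The loss over a time step of length at most 1: z s <= 2 expR 2 z t, because t + 1 <= 2 t, and V
    s >= expR (- m) V t. *)
Let kap := (2 * expR 2) `^ (lam - q) * expR (- m) `^ q.

Let kap_gt0 : 0 < kap.
Proof. by rewrite mulr_gt0 ?powR_gt0 ?mulr_gt0 ?expR_gt0. Qed.

(* [V] can decay at most like [expR (- m t)], hence lower bounds on [H] at [t]
   persist on [[t, t + 1]]. *)
Let G_ge t s : a <= t -> t <= s <= t + 1 -> kap * G t <= G s.
Proof.
move=> at_ /andP[ts st]; have Tt := le_trans Ta at_; have Ts := le_trans Tt ts.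
have zt := z_ge1 Tt; have zs := z_ge1 Ts.
have e0 : 0 <= expR 2 :> R := expR_ge0 _.
have Vts : expR (- m) * V t <= V s.
  have h : expR (m * t) * V t <= expR (m * s) * V s.
    apply: (is_derive_ge0_le ts (fun r rts => expmt (V' (le_trans Tt (proj1 (andP rts)))))).
    move=> r /andP[tr _]; rewrite mulr_ge0 ?expR_ge0//.
    by have [] := UXV (le_trans at_ tr).
  rewrite -(ler_pM2l (expR_gt0 (m * s))); apply: le_trans h.
  rewrite mulrA -expRD ler_wpM2r ?(ltW (Vgt0 Tt))// ler_expR.
  have : 0 <= m * (t + 1 - s) by rewrite mulr_ge0//; lra.
  lra.
have zts : z s <= 2 * expR 2 * z t.
  have -> : 2 * expR 2 * z t = (2 * t) * expR (2 + 2 * t) by rewrite /z (expRD 2); ring.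
  by rewrite ler_pM ?expR_ge0 ?ler_expR//; lra'.
have := expR_gt0 (- m) => em.
have -> : kap * G t = c * (2 * expR 2 * z t) `^ (lam - q) * (expR (- m) * V t) `^ q.
  have e2 : 0 <= 2 * expR 2 :> R by lra.
  rewrite (powRM _ e2) ?(le_trans ler01 zt)// (powRM _ (ltW em)) ?(ltW (Vgt0 Tt))//.
  have eqM (p u d y w : R) : p * u * (d * y * w) = d * (p * y) * (u * w) by ring.
  exact: eqM.
rewrite ler_pM ?mulr_ge0 ?powR_ge0 ?(ltW c0)//.
  by rewrite ler_wpM2l ?(ltW c0)// le0_ler_powR//; [rewrite subr_le0|lra].
by rewrite ge0_ler_powR ?nnegrE// ?mulr_ge0// ltW ?Vgt0.
Qed.

(** Integrate (expR (m t) Y)' = expR ((m + 2) t) H over [t, t + 1], where it is at least [g]; at the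
    right end Y <= - m U <= 0. *)
Let Y_le t : a <= t -> Y t <= - (kap * (expR (2 * t) * G t)).
Proof.
move=> at_; have Tt := le_trans Ta at_; have tt : t <= t + 1 by lra.
pose g := kap * (expR ((m + 2) * t) * G t).
have G0 : 0 <= G t by rewrite !mulr_ge0 ?powR_ge0// ltW.
have : expR (m * t) * Y t - g * t <= expR (m * (t + 1)) * Y (t + 1) - g * (t + 1).
  apply: (@is_derive_ge0_le _ (fun s => expR (m * s) * Y s - g * s)
    (fun s => expR ((m + 2) * s) * H s - g)) => // s /andP[ts st].
    have -> : (m + 2) * s = m * s + 2 * s by ring.
    by rewrite expRD; derive_pointwise; [apply: Y'; lra'|ring].
  rewrite subr_ge0 /g mulrCA ler_pM ?expR_ge0 ?(mulr_ge0 (ltW kap_gt0) G0)//.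
    by rewrite ler_expR ler_wpM2l//; lra'.
  by apply: le_trans (Hq (le_trans at_ ts)); apply: G_ge; rewrite ?ts.
have Y1 : expR (m * (t + 1)) * Y (t + 1) <= 0.
  rewrite mulr_ge0_le0 ?expR_ge0//.
  have [U1 _ _] := UXV (le_trans at_ tt).
  have := radial_K_le0 (le_trans Tt tt); have : 0 <= m * U (t + 1) by rewrite mulr_ge0.
  lra.
have -> : g = expR (m * t) * (kap * (expR (2 * t) * G t)).
  by rewrite /g mulrDl expRD; ring.
move=> h; rewrite -(ler_pM2l (expR_gt0 (m * t))); lra.
Qed.

(** The same for U' = Y, integrated back from U (t + 1) >= 0. Each of the two integrations costs one
    factor [kap]. *)
Let U_ge t : a <= t -> kap ^+ 2 * (expR (2 * t) * G t) <= U t.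
Proof.
move=> at_; have Tt := le_trans Ta at_; have tt : t <= t + 1 by lra.
pose g := kap ^+ 2 * (expR (2 * t) * G t).
have : U (t + 1) + g * (t + 1) <= U t + g * t.
  apply: (@is_derive_le0_le _ (fun s => U s + g * s) (fun s => Y s + g)) => //.
    by move=> s /andP[ts st]; derive_pointwise; [apply: U'; lra'|ring].
  move=> s /andP[ts st]; have := Y_le (le_trans at_ ts).
  suff : g <= kap * (expR (2 * s) * G s) by lra.
  have -> : g = kap * (expR (2 * t) * (kap * G t)) by rewrite /g; ring.
  rewrite ler_wpM2l ?(ltW kap_gt0)// ler_pM ?expR_ge0//.
  - by rewrite !mulr_ge0 ?powR_ge0// ltW.
  - by rewrite ler_expR; lra.
  - by apply: G_ge; rewrite ?ts.
have [U1 _ _] := UXV (le_trans at_ tt); rewrite -/g; lra.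
Qed.

(** In P' = expR ((m + 2) t) U insert [U_ge] and V >= expR (- m t) P / m, which is m V + X >= 0
    rewritten. This leaves a constant times P^q times the factor bounded below by [d], so
    [superlinear_growth_absurd] applies. *)
Lemma decaying_absurd (d : R) : 1 < q -> 0 < d ->
  ~ (forall t, a <= t -> d <= expR ((m + 4 - m * q) * t) * z t `^ (lam - q)).
Proof.
move=> q1 d0 hd.
(* For [m = 0] the hypotheses give 0 <= X < 0, so nothing decays in the plane. *)
have m_gt0 : 0 < m.
  rewrite lt_neqAle m0 andbT; apply/eqP => m_0.
  by have [_ X0] := UXV (lexx a); rewrite -m_0 mul0r add0r leNgt X0.
pose P t := - (expR (m * t) * X t).
apply: (@superlinear_growth_absurd _ P (fun t => expR ((m + 2) * t) * U t) a
  (kap ^+ 2 * c * (m^-1) `^ q * d) q) => //.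
- have k2 : 0 < kap ^+ 2 by rewrite exprn_gt0.
  have mq : 0 < m^-1 `^ q by rewrite powR_gt0 ?invr_gt0.
  by rewrite (mulr_gt0 (mulr_gt0 (mulr_gt0 k2 c0) mq)).
- move=> t at_; rewrite mulrDl expRD.
  by derive_pointwise; [exact: X' (le_trans Ta at_)|ring].
- by move=> t at_; have [_ Xt _] := UXV at_; rewrite /P -mulrN mulr_gt0 ?expR_gt0// oppr_gt0.
move=> t at_; have [_ Xt VXt] := UXV at_.
have P0 : 0 < P t by rewrite /P -mulrN mulr_gt0 ?expR_gt0// oppr_gt0.
have VP : m^-1 * (expR (- (m * t)) * P t) <= V t.
  rewrite mulrC ler_pdivrMr// /P mulrN mulrA -expRD addNr expR0; lra.
have VPq : (m^-1) `^ q * (expR (- (m * t) * q) * P t `^ q) <= V t `^ q.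
  rewrite expRM -!powRM ?expR_ge0 ?invr_ge0// ?mulr_ge0 ?expR_ge0 ?(ltW P0)//.
  rewrite ge0_ler_powR ?nnegrE ?mulr_ge0 ?invr_ge0 ?expR_ge0 ?(ltW P0)//.
  by rewrite ltW// Vgt0// (le_trans Ta).
have step : kap ^+ 2 * (expR ((m + 4) * t) * G t) <= expR ((m + 2) * t) * U t.
  have -> : (m + 4) * t = (m + 2) * t + 2 * t by ring.
  by rewrite expRD -mulrA mulrCA ler_wpM2l ?expR_ge0// U_ge.
apply: le_trans step.
have -> : kap ^+ 2 * c * m^-1 `^ q * d * P t `^ q =
  kap ^+ 2 * c * ((m^-1 `^ q * P t `^ q) * d) by ring.
have -> : kap ^+ 2 * (expR ((m + 4) * t) * G t) =
  kap ^+ 2 * c * (V t `^ q * (expR ((m + 4) * t) * z t `^ (lam - q))) by rewrite /G; ring.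
rewrite ler_wpM2l ?mulr_ge0 ?exprn_ge0 ?(ltW kap_gt0) ?(ltW c0)//.
have h : (m^-1 `^ q * P t `^ q) * d <= (m^-1 `^ q * P t `^ q) *
    (expR ((m + 4 - m * q) * t) * z t `^ (lam - q)).
  by rewrite ler_wpM2l ?hd// mulr_ge0 ?powR_ge0.
apply: le_trans h _.
have -> : (m + 4 - m * q) * t = - (m * t) * q + (m + 4) * t by ring.
rewrite expRD; set e1 := expR (_ * q) in VPq *.
have -> : m^-1 `^ q * P t `^ q * (e1 * expR ((m + 4) * t) * z t `^ (lam - q)) =
  (m^-1 `^ q * (e1 * P t `^ q)) * (expR ((m + 4) * t) * z t `^ (lam - q)) by ring.
by rewrite ler_wpM2r// mulr_ge0 ?powR_ge0 ?expR_ge0.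
Qed.

End Decaying.

Lemma radial_system_absurd : False.
Proof.
have [l0|l0] := ltP lam 0.
  have l01 : lam <= 0 <= lam + 1 by apply/andP; split; have := lamN1; lra.
  apply: (V_ge_absurd (lexx 0) l01 (or_introl erefl) ltr01 (lexx T)).
  by move=> t _; rewrite powRr0.
have [[c c0 [a Ta Vc]]|[a Ta UXV]] := radial_dichotomy.
  (* The least admissible exponent; it is at most lam + 1 because lam >= 0 here. *)
  pose q := Num.max lam 1.
  have q1 : 1 <= q by rewrite le_max lexx orbT.
  have q_ge0 : 0 <= q by lra.
  apply: (@V_ge_absurd q (c `^ q) a) => //.
  - rewrite le_max lexx/= ge_max; apply/andP; split; lra.
  - by right.
  - by rewrite powR_gt0.
  - move=> t at_; have Vt := Vgt0 (le_trans Ta at_).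
    by rewrite ge0_ler_powR ?nnegrE ?Vc ?(ltW c0) ?(ltW Vt).
(* An exponent above 1 with (m + 2) q0 = m + 3. If lam <= q0, the factor to be bounded below is
   t^(lam - q0) expR ((1 + 2 lam) t) >= t^(-2) expR t >= 1 / 2. If lam > q0, then q = lam and the
   factor is expR ((m + 4 - m lam) t) >= 1 by [mlam]. *)
pose q0 := 1 + (m + 2)^-1.
have m2 : 0 < m + 2 by lra'.
have q0_gt1 : 1 < q0 by rewrite /q0 ltrDl invr_gt0.
have q0_lt2 : q0 <= 2.
  suff : (m + 2)^-1 <= 1 by rewrite /q0; lra.
  by rewrite invf_le1//; lra'.
have mq0 : (m + 2) * q0 = m + 3 by rewrite /q0; field; lra.
pose q := Num.max lam q0.
have q1 : 1 < q by rewrite lt_max q0_gt1 orbT.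
have lq : lam <= q by rewrite le_max lexx.
have [c c0 [b Tb Hb]] := HV lq (or_intror (ltW q1)).
pose a' := Num.max a b.
have Ta' : T <= a' by rewrite le_max Ta.
have UXV' t : a' <= t -> [/\ 0 <= U t, X t < 0 & 0 <= m * V t + X t].
  by rewrite ge_max => /andP[/UXV].
have Hb' t : a' <= t -> c * z t `^ (lam - q) * V t `^ q <= H t.
  by rewrite ge_max => /andP[_ /Hb].
have q_ge0 : 0 <= q by lra.
apply: (@decaying_absurd q c a' lq q_ge0 c0 Ta' Hb' UXV' 2^-1 q1) => // t /(le_trans Ta') Tt.
have zt := z_ge1 Tt.
rewrite /q; case: (leP lam q0) => [lq0|lq0]; last first.
  rewrite subrr powRr0 mulr1 (@le_trans _ _ 1)//; first lra.
  rewrite -[leLHS]expR0 ler_expR mulr_ge0//; last lra'.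
  by rewrite subr_ge0.
have t0 : 0 <= t by lra'.
rewrite powRM ?expR_ge0// -expRM mulrCA -expRD.
have e1 : t <= (m + 4 - m * q0) * t + 2 * t * (lam - q0).
  have -> : (m + 4 - m * q0) * t + 2 * t * (lam - q0) =
    ((m + 4) + 2 * lam - (m + 2) * q0) * t by ring.
  by rewrite mq0 ler_peMl//; lra.
have e2 : 1 + t ^+ 2 / 2 <= expR t.
  by have := expR_ge1Dxn 1 t0; rewrite (_ : 2`!%:R = 2 :> R).
have t2 : t `^ (- 2) <= t `^ (lam - q0) by rewrite ler_powR; lra'.
have tt : 0 < t ^+ 2 by rewrite exprn_gt0//; lra'.
rewrite powR_invn// in t2.
apply: (@le_trans _ _ (t ^- 2 * expR t)).
  by rewrite mulrC ler_pdivlMr//; lra.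
by rewrite ler_pM ?invr_ge0 ?(ltW tt) ?expR_ge0 ?ler_expR.
Qed.

End RadialSystem.

(** * Directional derivatives and uniformity over compact sets *)

Section Lines.
Context {R : realType} {V : normedModType R}.

Lemma is_derive_lineP (f : V -> R) (x v : V) (t d : R) :
  is_derive (x + t *: v) v f d <-> is_derive t 1 (fun s => f (x + s *: v)) d.
Proof.
have eq_quot : (fun h : R => h^-1 *: ((f \o shift (x + t *: v)) (h *: v) - f (x + t *: v))) =
    (fun h => h^-1 *: (((fun s => f (x + s *: v)) \o shift t) (h *: (1 : R)) - f (x + t *: v))).
  apply/funext => h /=; congr (_ *: (f _ - _)).
  by rewrite [h *: 1]mulr1 scalerDl addrCA.
by split=> -[fx <-]; split; move: fx; rewrite /derivable /derive eq_quot.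
Qed.

Lemma is_derive_line (f : V -> R) (x v : V) (t d : R) :
  is_derive (x + t *: v) v f d -> is_derive t 1 (fun s => f (x + s *: v)) d.
Proof. by move/is_derive_lineP. Qed.

(** Restriction to the line through [x] reduces this to the one-variable chain rule, so one
    directional derivative of [f] suffices. *)
Lemma is_derive_chain (p : R -> R) (f : V -> R) (x v : V) (d d' : R) :
  is_derive (f x) 1 p d' -> is_derive x v f d ->
  is_derive x v (fun y => p (f y)) (d' * d).
Proof.
rewrite -{1 2}(addr0 x) -{1 2}(scale0r v) => dp /is_derive_lineP df.
by rewrite -(addr0 x) -(scale0r v); apply/is_derive_lineP; exact: is_derive1_chain dp df.
Qed.

End Lines.

Section CompactUniformity.
Context {R : realType} {S : pseudoMetricType R} {T : topologicalType}.

(** The near-covering form of compactness extracts one neighbourhood of [s] from joint continuity at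
    every (s, y); f t y' and f s y' are compared through f s y. *)
Lemma compact_uniform_cvg (K : set T) (f : S -> T -> R) (s : S) : compact K ->
  (forall y, K y -> f p.1 p.2 @[p --> (s, y)] --> f s y) ->
  forall e, 0 < e -> \forall t \near s, forall y, K y -> `|f t y - f s y| < e.
Proof.
move=> /compact_near_coveringP Kc fc e e0.
apply: (Kc S (nbhs s) (fun t y => `|f t y - f s y| < e)) => y Ky.
have e2 : 0 < e / 2 by rewrite divr_gt0.
have /= /cvgrPdist_lt/(_ _ e2)[[A B]/= [As By] AB] := fc y Ky.
exists (B, A) => //= -[y' t]/= [By' At].
have h1 := AB (t, y') (conj At By').
have h2 := AB (s, y') (conj (nbhs_singleton As) By').
rewrite /= in h1 h2; rewrite distrC in h1.
have := ler_distD (f s y) (f t y') (f s y'); lra.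
Qed.

Lemma compact_bounded_continuous (K : set T) (f : T -> R) : compact K ->
  (forall y, K y -> {for y, continuous f}) ->
  exists M, forall y, K y -> `|f y| <= M.
Proof.
move=> /compact_near_coveringP Kc fc.
have : \forall M \near +oo, K `<=` (fun y => `|f y| <= M).
  apply: Kc => y Ky.
  have /cvgrPdist_lt/(_ _ ltr01) Ay := fc y Ky.
  exists ([set t | `|f y - f t| < 1], [set M | `|f y| + 1 <= M]).
    by split => //=; apply: nbhs_pinfty_ge; rewrite num_real.
  move=> -[y' M]/= [fy' hM]; apply: le_trans hM.
  have := ler_distD (f y) (f y') 0; rewrite !subr0 distrC; lra.
by move=> /filter_ex[M KM]; exists M.
Qed.

Lemma compact_gt0_continuous (K : set T) (f : T -> R) :
  compact K -> (forall y, K y -> {for y, continuous f}) ->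
  (forall y, K y -> 0 < f y) -> exists2 e, 0 < e & forall y, K y -> e <= f y.
Proof.
move=> cK cf f0.
have [y Ky|M KM] := @compact_bounded_continuous K (fun y => (f y)^-1) cK.
  by apply: cvgV; [rewrite gt_eqF// f0|exact: cf].
exists (`|M| + 1)^-1; first by rewrite invr_gt0 ltr_wpDl.
move=> y Ky; have fy := f0 y Ky.
rewrite -[leRHS]invrK lef_pV2 ?posrE ?invr_gt0 ?ltr_wpDl//.
have := KM y Ky; rewrite gtr0_norm ?invr_gt0// => /le_trans; apply.
by have := ler_norm M; lra.
Qed.

End CompactUniformity.
(** * An integral over a cube *)

Section Mean.
Context {R : realType} {n : nat}.
Implicit Types (F G : 'rV[R]_n -> R) (y : 'rV[R]_n) (i j : 'I_n) (N : nat).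

Definition box : set 'rV[R]_n := [set y | forall i, -3 <= y ord0 i <= 3].

Lemma compact_box : compact box.
Proof.
have -> : box = [set y : 'rV[R]_n | forall i, (fun=> `[-3, 3]%classic) i (y ord0 i)].
  by apply/funext => y; apply/propext; split=> h i; have := h i; rewrite /= in_itv.
apply: (rV_compact (T := R) (A := fun=> `[-3, 3]%classic)) => i.
exact: segment_compact.
Qed.

Definition bounded_on_box F := exists M, forall y, box y -> `|F y| <= M.

(* The functional plays the role of the normalized integral over [box]; being
   defined on all bounded functions, it needs no measurability. *)
Definition is_mean (I : ('rV[R]_n -> R) -> R) : Prop :=
  [/\ forall a F G, bounded_on_box F -> bounded_on_box G ->
        I (fun y => a * F y + G y) = a * I F + I G,
      forall F, bounded_on_box F -> (forall y, box y -> 0 <= F y) -> 0 <= I F,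
      I (fun=> 1) = 1,
      forall F j, (forall y, derivable F y (delta_mx ord0 j)) ->
        continuous (partial j F) ->
        (forall y, 3 <= `|y ord0 j| -> F y = 0) -> I (partial j F) = 0 &
      forall F c d e, bounded_on_box F -> (forall y, box y -> 0 <= F y) ->
        -3 <= c -> c < d -> d <= 3 -> 0 < e ->
        (forall y, (forall i, c <= y ord0 i <= d) -> e <= F y) -> 0 < I F].

(** Left endpoints of N + 1 equal cells of [-3, 3]; the point 3 is left out, so a shift by one step
    permutes the grid up to wrapping the last point to -3. *)
Let gridc N k : R := -3 + (6 / N.+1%:R) * k%:R.
Let gridpt N (k : {ffun 'I_n -> 'I_N.+1}) : 'rV[R]_n := \row_i gridc N (k i).
Let avg N F : R :=
  (\sum_(k : {ffun 'I_n -> 'I_N.+1}) F (gridpt k)) / (N.+1 ^ n)%:R.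

Let step_gt0 N : 0 < 6 / N.+1%:R :> R.
Proof. by rewrite divr_gt0// ltr0n. Qed.

Let gridcN N : gridc N N.+1 = 3.
Proof. by rewrite /gridc divfK ?pnatr_eq0//; ring. Qed.

Let box_gridpt N (k : {ffun 'I_n -> 'I_N.+1}) : box (gridpt k).
Proof.
move=> i; rewrite mxE -{2}(gridcN N) /gridc lerDl lerD2l.
by rewrite ler_pM2l ?step_gt0// ler_nat (ltnW (ltn_ord _)) mulr_ge0.
Qed.

Let card_gridE N : (N.+1 ^ n)%:R = #|{ffun 'I_n -> 'I_N.+1}|%:R :> R.
Proof. by rewrite card_ffun !card_ord. Qed.

Let card_grid_gt0 N : 0 < (N.+1 ^ n)%:R :> R.
Proof. by rewrite ltr0n expn_gt0. Qed.

Let avg_linear N a F G : avg N (fun y => a * F y + G y) = a * avg N F + avg N G.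
Proof. by rewrite /avg big_split/= -mulr_sumr mulrDl mulrA. Qed.

Let avg_le N F G : (forall y, box y -> F y <= G y) -> avg N F <= avg N G.
Proof.
move=> FG; rewrite ler_wpM2r ?invr_ge0 ?(ltW (card_grid_gt0 N))//.
by apply: ler_sum => k _; exact/FG/box_gridpt.
Qed.

Let avg_const N (c : R) : avg N (fun=> c) = c.
Proof.
by rewrite /avg sumr_const -[c *+ _]mulr_natr card_gridE mulfK// -card_gridE gt_eqF.
Qed.

Let avg_norm N F (M : R) : (forall y, box y -> `|F y| <= M) -> `|avg N F| <= M.
Proof.
move=> FM; have h y : box y -> - M <= F y <= M by move=> /FM; rewrite ler_norml.
rewrite ler_norml; apply/andP; split.
  by rewrite -(avg_const N (- M)); apply: avg_le => y /h/andP[].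
by rewrite -[leRHS](avg_const N M); apply: avg_le => y /h/andP[].
Qed.

Let shift_grid N j (k : {ffun 'I_n -> 'I_N.+1}) : {ffun 'I_n -> 'I_N.+1} :=
  [ffun i => if i == j then ordS (k i) else k i].

Let shift_grid_inj N j : injective (@shift_grid N j).
Proof.
move=> k l kl; apply/ffunP => i; have /ffunP/(_ i) := kl.
by rewrite !ffunE; case: eqP => // _ /ordS_inj.
Qed.

(* The grid is invariant under cyclic shifts, and [F] vanishes where the shift
   wraps around. *)
Let avg_shift N j F : (forall y, 3 <= `|y ord0 j| -> F y = 0) ->
  avg N (fun y => F (y + (6 / N.+1%:R) *: delta_mx ord0 j)) = avg N F.
Proof.
move=> F0; congr (_ / _); rewrite [RHS](reindex_inj (@shift_grid_inj N j)).
apply: eq_bigr => k _; have [kN|kN] := ltnP (k j).+1 N.+1.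
  congr F; apply/rowP => i; rewrite !mxE ffunE eqxx/=.
  case: eqP => [->|_]; last by rewrite mulr0 addr0.
  by rewrite /= modn_small// /gridc -addn1 natrD; ring.
have {kN}kN : (k j).+1 = N.+1 by apply/eqP; rewrite eqn_leq kN ltn_ord.
rewrite !F0// !mxE ?ffunE ?eqxx/=.
  by rewrite kN modnn /gridc mulr0 addr0 normrN ger0_norm.
have -> : gridc N (k j) + 6 / N.+1%:R * 1 = gridc N (k j).+1.
  by rewrite /gridc -[in RHS]addn1 natrD; ring.
by rewrite kN gridcN ger0_norm.
Qed.

Let step_cvg0 : 6 / N.+1%:R @[N --> \oo] --> (0 : R).
Proof. by rewrite -[0](mulr0 6); apply: cvgMr; exact: cvg_harmonic. Qed.

(** By [avg_shift] the difference quotients of [F] with the grid step average to zero. The mean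
    value theorem and uniform continuity over the box keep them within [e] of the partial
    derivative. *)
Let avg_partial F j : (forall y, derivable F y (delta_mx ord0 j)) ->
  continuous (partial j F) -> (forall y, 3 <= `|y ord0 j| -> F y = 0) ->
  avg N (partial j F) @[N --> \oo] --> (0 : R).
Proof.
move=> dF cF F0; apply/cvgrPdist_le => e e0.
have : \forall h \near (0 : R), forall y, box y ->
    `|partial j F (y + h *: delta_mx ord0 j) - partial j F y| < e.
  have cG y : box y ->
      partial j F (p.2 + p.1 *: delta_mx ord0 j) @[p --> (0 : R, y)] -->
      partial j F (y + 0 *: delta_mx ord0 j).
    move=> _; apply: continuous_cvg; first exact: cF.
    by apply: cvgD; [exact: cvg_snd | apply: cvgZr_tmp; exact: cvg_fst].
  have := compact_uniform_cvg
    (f := fun (h : R) y => partial j F (y + h *: delta_mx ord0 j)) compact_box cG e0.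
  by apply: filterS => h H y yB; have := H y yB; rewrite scale0r addr0.
move=> /nbhs_ballP[d /= d0 hd]; have /cvgrPdist_lt/(_ d d0) := step_cvg0.
apply: filterS => N; rewrite !sub0r !normrN gtr0_norm ?step_gt0// => hN.
set h := 6 / N.+1%:R in hN; have h0 : 0 < h by exact: step_gt0.
have FE : avg N (partial j F) = avg N (fun y => h^-1 * F y +
    (partial j F y - h^-1 * F (y + h *: delta_mx ord0 j))).
  rewrite avg_linear.
  have -> : avg N (fun y => partial j F y - h^-1 * F (y + h *: delta_mx ord0 j)) =
      avg N (fun y => (- h^-1) * F (y + h *: delta_mx ord0 j) + partial j F y).
    by congr (_ / _); apply: eq_bigr => k _; rewrite addrC mulNr.
  by rewrite avg_linear avg_shift//; ring.
rewrite FE; apply: avg_norm => y yB.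
have [c /andP[c0 ch] Fc] := MVT_le (ltW h0)
  (fun t _ => is_derive_line (derivableP (dF (y + t *: delta_mx ord0 j)))).
rewrite scale0r addr0 subr0 in Fc.
have -> : h^-1 * F y + (partial j F y - h^-1 * F (y + h *: delta_mx ord0 j)) =
  - (partial j F (y + c *: delta_mx ord0 j) - partial j F y).
  rewrite -(subrK (F y) (F (y + h *: _))) Fc /partial; field; lra.
rewrite normrN; apply/ltW/hd => //; rewrite /ball/= sub0r normrN ger0_norm//.
exact: le_lt_trans hN.
Qed.

Let cells (c d : R) N : {set 'I_N.+1} := [set k : 'I_N.+1 | c <= gridc N k <= d]%SET.

Let card_cells (c d : R) : -3 <= c -> c < d -> d <= 3 ->
  \forall N \near \oo, (d - c) / 12 <= #|cells c d N|%:R / N.+1%:R.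
Proof.
move=> c3 cd d3; have dc2 : 0 < (d - c) / 2 by lra.
have /cvgrPdist_lt/(_ _ dc2) := step_cvg0.
apply: filterS => N; rewrite !sub0r !normrN gtr0_norm ?step_gt0// => hN.
set h := 6 / N.+1%:R in hN; have h0 : 0 < h by exact: step_gt0.
(* Along the grid [clamp] climbs from c + h to [d], by at most [h] per step and only at grid points
   of [c, d]. Telescoping shows that [h] times the number of cells is at least d - c - h >= (d - c)
   / 2. *)
pose clamp t := Num.max (c + h) (Num.min t d).
have gS k : gridc N k.+1 = gridc N k + h by rewrite /gridc -/h -addn1 natrD; ring.
have : \sum_(k < N.+1) (clamp (gridc N k.+1) - clamp (gridc N k)) <=
    \sum_(k < N.+1) h * (k \in cells c d N)%:R.
  apply: ler_sum => k _; rewrite inE gS /clamp; set g := gridc N k.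
  case: (boolP (c <= g <= d)) => [/andP[cg gd]|gcd].
    rewrite mulr1 (min_l gd).
    by case: (leP (g + h) d) => ?; rewrite max_r; try lra; case: (leP (c + h) g) => ?; lra.
  rewrite mulr0; move: gcd; rewrite negb_and -!ltNge => /orP[gc|gd].
    by rewrite !max_l ?ge_min; lra.
  by rewrite !min_r; lra.
rewrite -(big_mkord xpredT (fun k => clamp (gridc N k.+1) - clamp (gridc N k))).
rewrite telescope_sumr// gridcN -mulr_sumr -natr_sum -big_mkcond sum1_card.
have -> : clamp 3 = d by rewrite /clamp min_r// max_r//; lra.
have -> : clamp (gridc N 0) = c + h.
  by rewrite /clamp max_l// ge_min /gridc mulr0; lra.
have -> : #|cells c d N|%:R / N.+1%:R = (h * #|cells c d N|%:R) / 6 :> R.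
  by rewrite /h; move: (ltr0Sn R N); set M := N.+1%:R => M0; field; lra.

lra.
Qed.

Let avg_ge F (c d e : R) : (forall y, box y -> 0 <= F y) ->
  -3 <= c -> c < d -> d <= 3 -> 0 < e ->
  (forall y, (forall i, c <= y ord0 i <= d) -> e <= F y) ->
  \forall N \near \oo, e * ((d - c) / 12) ^+ n <= avg N F.
Proof.
move=> F0 c3 cd d3 e0 Fe; apply: filterS (card_cells c3 cd d3) => N hN.
have dc : 0 <= (d - c) / 12 by lra.
apply: (@le_trans _ _ (e * (#|cells c d N|%:R / N.+1%:R) ^+ n)).
  by rewrite ler_pM2l// lerXn2r// nnegrE (le_trans dc).
pose K : pred {ffun 'I_n -> 'I_N.+1} := ffun_on (cells c d N).
have cardK : #|K| = (#|cells c d N| ^ n)%N by rewrite card_ffun_on card_ord.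
rewrite expr_div_n -!natrX mulrA ler_wpM2r ?invr_ge0// -cardK mulr_natr -sumr_const.
rewrite [leLHS]big_mkcond/=; apply: ler_sum => k _.
case: ifPn => [/ffun_onP kA|_]; last exact/F0/box_gridpt.
by apply: Fe => i; have := kA i; rewrite inE mxE.
Qed.

(* The functional is the limit of averages over finer and finer grids along an
   ultrafilter, so every bounded function has a mean. *)
Lemma is_mean_exists : exists I, is_mean I.
Proof.
have [W [WU Wsub]] := @ultraFilterLemma _ \oo eventually_filter.
have WP : ProperFilter W by exact: ultra_proper.
have avg_cvg F : bounded_on_box F -> cvg (avg N F @[N --> W]).
  move=> [M FM]; have UF : UltraFilter (avg N F @[N --> W]).
    split=> [|G GP WG]; first exact: fmap_proper_filter.
    apply/seteqP; split=> A GA; last exact: WG.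
    have [//|WA] := @in_ultra_setVsetC _ W ((fun N => avg N F) @^-1` A) WU.
    have : G (A `&` ~` A) by apply: filterI => //; exact: WG.
    by rewrite setICr => /filter_not_empty.
  have : compact `[- M, M]%classic by exact: segment_compact.
  rewrite compact_ultra => /(_ _ UF)[|p [_ pl]]; last by apply/cvg_ex; exists p.
  change (W ((fun N => avg N F) @^-1` `[- M, M]%classic)).
  by apply: filterE => N; rewrite /= in_itv/= -ler_norml; exact: avg_norm.
exists (fun F => lim (avg N F @[N --> W])); split.
- move=> a F G bF bG; apply: cvg_lim => //.
  under eq_fun do rewrite avg_linear.
  by apply: cvgD; [apply: cvgMr; exact: avg_cvg|exact: avg_cvg].
- move=> F bF F0; apply: limr_ge; first exact: avg_cvg.
  by apply: nearW => N; rewrite -(avg_const N 0); exact: avg_le.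
- by apply: cvg_lim => //; under eq_fun do rewrite avg_const; exact: cvg_cst.
- move=> F j dF cF F0; apply: cvg_lim => //.
  by apply: cvg_trans (avg_partial dF cF F0); exact: cvg_app.
- move=> F c d e bF F0 c3 cd d3 e0 Fe.
  apply: (@lt_le_trans _ _ (e * ((d - c) / 12) ^+ n)).
    by rewrite mulr_gt0// exprn_gt0//; lra.
  apply: limr_ge; first exact: avg_cvg.
  by apply: Wsub; exact: (avg_ge F0 c3 cd d3 e0 Fe).
Qed.

End Mean.

(** * C^k functions *)

Section SmoothFunctions.
Context {R : realType} {n : nat}.
Implicit Types (f g : 'rV[R]_n -> R) (x y v w : 'rV[R]_n) (i j : 'I_n)
  (U : set 'rV[R]_n) (k : nat).

Local Notation e_ i := (delta_mx ord0 i : 'rV[R]_n).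

Lemma Ck_open_continuous k U f x : Ck_open k U f -> U x -> {for x, continuous f}.
Proof. by case: k => [|k] [cf _] Ux; exact: cf. Qed.

Lemma Ck_open_partial k U f i : Ck_open k.+1 U f -> Ck_open k U (partial i f).
Proof. by move=> [_ /(_ i)[]]. Qed.

Lemma Ck_open_is_derive k U f i x : Ck_open k.+1 U f -> U x ->
  is_derive x (e_ i) f (partial i f x).
Proof. by move=> [_ /(_ i)[df _]] Ux; exact/derivableP/df. Qed.

Lemma Ck_openW k U f : Ck_open k.+1 U f -> Ck_open k U f.
Proof.
elim: k f => [|k IH] f [cf df]; first by split.
by split=> // i; have [dfi Cfi] := df i; split=> //; exact: IH.
Qed.

Lemma eq_partial U f g i x : open U -> {in U, f =1 g} -> U x ->
  partial i f x = partial i g x.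
Proof.
move=> oU fg Ux; apply: near_eq_derive.
by apply: filterS (open_nbhs_nbhs (conj oU Ux)) => y Uy; apply: fg; rewrite inE.
Qed.

Lemma near_eq_continuous f g x : (\near x, f x = g x) ->
  {for x, continuous f} -> {for x, continuous g}.
Proof.
move=> fg cf; change (g z @[z --> x] --> g x); rewrite -(nbhs_singleton fg).
exact: cvg_trans (@near_eq_cvg _ _ (nbhs x) _ _ _ fg) cf.
Qed.

Lemma eq_Ck_open k U f g : open U -> {in U, f =1 g} ->
  Ck_open k U f -> Ck_open k U g.
Proof.
move=> oU; have near_fg f' g' x : {in U, f' =1 g'} -> U x -> \near x, f' x = g' x.
  move=> fg Ux.
  by apply: filterS (open_nbhs_nbhs (conj oU Ux)) => y Uy; apply: fg; rewrite inE.
elim: k f g => [|k IH] f g fg [cf df].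
  by split=> // x Ux; apply: near_eq_continuous (cf x Ux); exact: near_fg.
split=> [x Ux|i]; first by apply: near_eq_continuous (cf x Ux); exact: near_fg.
have [dfi Cfi] := df i; split=> [x Ux|].
  by apply: near_eq_derivable (dfi x Ux); exact: near_fg.
by apply: IH Cfi => x; rewrite inE => Ux; exact: (eq_partial i oU fg Ux).
Qed.

Lemma Ck_open_const k U (c : R) : Ck_open k U (fun=> c).
Proof.
have cstc (d : R) x : {for x, continuous (fun _ : 'rV[R]_n => d)} by exact: cst_continuous.
elim: k c => [|k IH] c; first by split=> // x _; exact: cstc.
split=> [x _|i]; first exact: cstc.
split=> [x _|]; first exact: derivable_cst.
suff -> : partial i (fun _ : 'rV[R]_n => c) = fun=> 0 by exact: IH.
by apply/funext => x; rewrite /partial derive_cst.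
Qed.

Lemma Ck_open_add k U f g : open U -> Ck_open k U f -> Ck_open k U g ->
  Ck_open k U (fun x => f x + g x).
Proof.
move=> oU; elim: k f g => [|k IH] f g [cf df] [cg dg].
  by split=> // x Ux; exact: continuousD (cf x Ux) (cg x Ux).
split=> [x Ux|i]; first by exact: continuousD (cf x Ux) (cg x Ux).
have [dfi Cfi] := df i; have [dgi Cgi] := dg i.
split=> [x Ux|]; first exact: derivableD (dfi x Ux) (dgi x Ux).
apply: eq_Ck_open (IH _ _ Cfi Cgi) => // x; rewrite inE => Ux.
by apply/esym; exact: deriveD (dfi x Ux) (dgi x Ux).
Qed.

Lemma Ck_open_mul k U f g : open U -> Ck_open k U f -> Ck_open k U g ->
  Ck_open k U (fun x => f x * g x).
Proof.
move=> oU; elim: k f g => [|k IH] f g Cf Cg.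
  by split=> // x Ux; exact: continuousM (Ck_open_continuous Cf Ux) (Ck_open_continuous Cg Ux).
split=> [x Ux|i].
  by exact: continuousM (Ck_open_continuous Cf Ux) (Ck_open_continuous Cg Ux).
have dfg x : U x -> is_derive x (e_ i) (fun x => f x * g x)
    (partial i f x * g x + f x * partial i g x).
  by move=> Ux; apply: is_derive_mul;
    [exact: Ck_open_is_derive Cf Ux|exact: Ck_open_is_derive Cg Ux].
split=> [x /dfg[]//|].
have := Ck_open_add oU (IH _ _ (Ck_open_partial i Cf) (Ck_openW Cg))
  (IH _ _ (Ck_openW Cf) (Ck_open_partial i Cg)).
by apply: eq_Ck_open => // x; rewrite inE => /dfg[_ <-].
Qed.

Lemma Ck_open_sum k U m (f : 'I_m -> 'rV[R]_n -> R) : open U ->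
  (forall l, Ck_open k U (f l)) -> Ck_open k U (fun x => \sum_(l < m) f l x).
Proof.
move=> oU; elim: m f => [|m IH] f Cf.
  by under eq_fun do rewrite big_ord0; exact: Ck_open_const.
under eq_fun do rewrite big_ord_recl.
by apply: Ck_open_add => //; exact: IH.
Qed.

Lemma Ck_open_laplacian k U f : open U -> Ck_open k.+2 U f ->
  Ck_open k U (laplacian f).
Proof.
by move=> oU Cf; apply: Ck_open_sum => // i; do 2 apply: Ck_open_partial.
Qed.

Lemma is_derive_cvg {V : normedModType R} (F : V -> R) (x v : V) (l : R) :
  h^-1 *: (F (h *: v + x) - F x) @[h --> 0^'] --> l -> is_derive x v F l.
Proof.
move=> Fl; split; first by apply/cvg_ex; exists l.
exact: cvg_lim.
Qed.

(** The increment along h (c e_i + w) splits into the step h w and a coordinate step based at the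
    moving point x + h w. The mean value theorem along e_i and continuity of the partial derivative
    handle the latter. *)
Let is_derive_step U f x w i (c d : R) : open U -> Ck_open 1 U f -> U x ->
  is_derive x w f d -> is_derive x (c *: e_ i + w) f (c * partial i f x + d).
Proof.
move=> oU Cf Ux [/cvg_ex[l fl] fd].
have {fd}ld : l = d by rewrite -fd; apply/esym; exact: cvg_lim.
apply: is_derive_cvg.
have -> : (fun h : R => h^-1 *: (f (h *: (c *: e_ i + w) + x) - f x)) =
    (fun h => h^-1 *: (f (h *: w + x + (h * c) *: e_ i) - f (h *: w + x)) +
              h^-1 *: (f (h *: w + x) - f x)).
  apply/funext => h; rewrite -scalerDr addrA subrK; congr (_ *: (f _ - _)).
  by rewrite scalerDr scalerA -addrA addrC.
apply: cvgD; last by rewrite -ld.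
apply/cvgrPdist_lt => e e0; pose K := `|w| + `|c| * `|e_ i|.
have K0 : 0 <= K by rewrite addr_ge0 ?mulr_ge0.
have e1 : 0 < e / (`|c| + 1) by rewrite divr_gt0// ltr_wpDl.
have cfi : {for x, continuous (partial i f)}.
  exact: Ck_open_continuous (Ck_open_partial i Cf) Ux.
have /cvgrPdist_lt/(_ _ e1) := cfi.
move/(filterI (open_nbhs_nbhs (conj oU Ux))) => /nbhs_ballP[r /= r0 rP].
have rK : 0 < r / (K + 1) by rewrite divr_gt0// ltr_wpDl.
have in_ball (h s : R) : 0 <= s <= 1 -> `|h| < r / (K + 1) ->
    ball x r (h *: w + x + (s * (h * c)) *: e_ i).
  move=> /andP[s0 s1] hr; rewrite -ball_normE /ball_ /= distrC.
  have -> : h *: w + x + (s * (h * c)) *: e_ i - x = h *: w + (s * (h * c)) *: e_ i.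
    by rewrite addrAC addrK.
  have hK : `|h| * (K + 1) < r by rewrite -ltr_pdivlMr// ltr_wpDl.
  apply: le_lt_trans (ler_normD _ _) _; rewrite normrZ.
  rewrite [`|_ *: e_ i|]normrZ !normrM (ger0_norm s0).
  apply: le_lt_trans hK; have hc : 0 <= `|h| * `|c| * `|e_ i| by rewrite !mulr_ge0.
  have : s * (`|h| * `|c| * `|e_ i|) <= `|h| * `|c| * `|e_ i| by rewrite ler_piMl.
  have := normr_ge0 h; rewrite /K; lra.
apply: filterS2 (dnbhs0_lt rK) (nbhs_dnbhs_neq (0 : R)) => /= h hr h0.
have df (s : R) : 0 <= s <= 1 -> is_derive s 1
    (fun s => f (h *: w + x + (s * (h * c)) *: e_ i))
    (partial i f (h *: w + x + (s * (h * c)) *: e_ i) * (h * c)).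
  move=> s01; have [Us _] := rP _ (in_ball h s s01 hr).
  apply: (@is_derive1_chain _ (fun t => f (h *: w + x + t *: e_ i)) (fun s => s * (h * c))).
    by apply: is_derive_line; exact: Ck_open_is_derive Cf Us.
  by derive_pointwise; ring.
have [s s01 fs] := MVT_le ler01 df.
rewrite mul1r mul0r scale0r addr0 subr0 mulr1 in fs.
have [_ /= fse] := rP _ (in_ball h s s01 hr).
have sE (p : R) : (h : R)^-1 *: (p * (h * c)) = c * p.
  by transitivity ((h : R)^-1 * (p * (h * c))) => //; field.
rewrite fs sE; set p := partial i f _ in fse *.
rewrite -mulrBr normrM.
rewrite ltr_pdivlMr in fse; last by rewrite ltr_wpDl.
by apply: le_lt_trans fse; rewrite mulrC ler_wpM2l// lerDl.
Qed.

Lemma is_derive_gradient U f x v : open U -> Ck_open 1 U f -> U x ->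
  is_derive x v f (\sum_(i < n) v ord0 i * partial i f x).
Proof.
move=> oU Cf Ux; rewrite {1}(row_sum_delta v).
suff : forall s : seq 'I_n, is_derive x (\sum_(i <- s) v ord0 i *: e_ i) f
  (\sum_(i <- s) v ord0 i * partial i f x) by exact.
elim=> [|i s IH]; first by rewrite !big_nil; exact: is_derive0.
by rewrite !big_cons; exact: (is_derive_step i (v ord0 i) oU Cf Ux IH).
Qed.

End SmoothFunctions.

Section BoundedFunctions.
Context {R : realType} {n : nat}.
Implicit Types (F G : 'rV[R]_n -> R) (y : 'rV[R]_n) (s : R).

Lemma bounded_on_box_const (c : R) : bounded_on_box (fun _ : 'rV[R]_n => c).
Proof. by exists `|c|. Qed.

Lemma bounded_on_boxD F G : bounded_on_box F -> bounded_on_box G ->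
  bounded_on_box (fun y => F y + G y).
Proof.
move=> [M FM] [N GN]; exists (M + N) => y yB.
by rewrite (le_trans (ler_normD _ _))// lerD ?FM ?GN.
Qed.

Lemma bounded_on_boxZ (a : R) F : bounded_on_box F ->
  bounded_on_box (fun y => a * F y).
Proof.
by move=> [M FM]; exists (`|a| * M) => y yB; rewrite normrM ler_wpM2l ?FM.
Qed.

Lemma bounded_on_box_sum m (F : 'I_m -> 'rV[R]_n -> R) :
  (forall i, bounded_on_box (F i)) ->
  bounded_on_box (fun y => \sum_(i < m) F i y).
Proof.
elim: m F => [|m IH] F bF.
  by under eq_fun do rewrite big_ord0; exact: bounded_on_box_const.
under eq_fun do rewrite big_ord_recl.
by apply: bounded_on_boxD => //; exact: IH.
Qed.

Lemma bounded_on_box_continuous F : (forall y, box y -> {for y, continuous F}) ->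
  bounded_on_box F.
Proof. by move=> cF; exact: compact_bounded_continuous compact_box cF. Qed.

End BoundedFunctions.

(** * Calculus with the mean functional *)

Section MeanTheory.
Context {R : realType} {n : nat} {I : ('rV[R]_n -> R) -> R} (meanI : is_mean I).
Implicit Types (F G : 'rV[R]_n -> R) (y : 'rV[R]_n) (s : R).

Lemma mean_linear (a : R) F G : bounded_on_box F -> bounded_on_box G ->
  I (fun y => a * F y + G y) = a * I F + I G.
Proof. by case: meanI => + _ _ _ _; exact. Qed.

Lemma meanD F G : bounded_on_box F -> bounded_on_box G ->
  I (fun y => F y + G y) = I F + I G.
Proof.
move=> bF bG; rewrite -[I F]mul1r -mean_linear//.
by congr I; apply/funext => y; rewrite mul1r.
Qed.

Lemma mean0 : I (fun=> 0) = 0.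
Proof.
have b0 := @bounded_on_box_const R n 0.
have := meanD b0 b0; rewrite (_ : (fun _ : 'rV[R]_n => 0 + 0) = fun=> 0); last first.
  by apply/funext => y; rewrite addr0.
by move=> /eqP; rewrite -subr_eq0 opprD addrA subrr sub0r oppr_eq0 => /eqP.
Qed.

Lemma meanZ (a : R) F : bounded_on_box F -> I (fun y => a * F y) = a * I F.
Proof.
move=> bF; rewrite -[RHS]addr0 -mean0 -mean_linear//; last exact: bounded_on_box_const.
by congr I; apply/funext => y; rewrite addr0.
Qed.

Lemma mean_sum m (F : 'I_m -> 'rV[R]_n -> R) : (forall i, bounded_on_box (F i)) ->
  I (fun y => \sum_(i < m) F i y) = \sum_(i < m) I (F i).
Proof.
elim: m F => [|m IH] F bF.
  by under eq_fun do rewrite big_ord0; rewrite mean0 big_ord0.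
under eq_fun do rewrite big_ord_recl.
rewrite meanD//; last by apply: bounded_on_box_sum => i; exact: bF.
by rewrite IH ?big_ord_recl// => i; exact: bF.
Qed.

Lemma mean_ge0 F : bounded_on_box F -> (forall y, box y -> 0 <= F y) -> 0 <= I F.
Proof. by case: meanI => _ + _ _ _; exact. Qed.

Lemma mean_const (c : R) : I (fun=> c) = c.
Proof.
case: meanI => _ _ I1 _ _; rewrite -[RHS]mulr1 -I1 -meanZ; last exact: bounded_on_box_const.
by congr I; apply/funext => y; rewrite mulr1.
Qed.

Lemma mean_le F G : bounded_on_box F -> bounded_on_box G ->
  (forall y, box y -> F y <= G y) -> I F <= I G.
Proof.
move=> bF bG FG; rewrite -subr_ge0 addrC -mulN1r -mean_linear//.
apply: mean_ge0 => [|y yB]; last by rewrite mulN1r addrC subr_ge0 FG.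
by apply: bounded_on_boxD => //; exact: bounded_on_boxZ.
Qed.

Lemma mean_norm_le F (M : R) : (forall y, box y -> `|F y| <= M) -> `|I F| <= M.
Proof.
move=> FM; have bF : bounded_on_box F by exists M.
have FMl y : box y -> - M <= F y <= M by move=> /FM; rewrite ler_norml.
rewrite ler_norml; apply/andP; split.
  rewrite -(mean_const (- M)); apply: mean_le (bounded_on_box_const _) bF _.
  by move=> y /FMl/andP[].
rewrite -[leRHS](mean_const M); apply: mean_le bF (bounded_on_box_const _) _.
by move=> y /FMl/andP[].
Qed.

Lemma mean_gt0 F (c d e : R) : bounded_on_box F -> (forall y, box y -> 0 <= F y) ->
  -3 <= c -> c < d -> d <= 3 -> 0 < e ->
  (forall y, (forall i, c <= y ord0 i <= d) -> e <= F y) -> 0 < I F.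
Proof. by case: meanI => _ _ _ _; exact. Qed.

Lemma mean_partial F j : Ck_open 1 setT F ->
  (forall y, 3 <= `|y ord0 j| -> F y = 0) -> I (partial j F) = 0.
Proof.
move=> CF F0; case: meanI => _ _ _ + _; apply => //.
  by move=> y; have [] := Ck_open_is_derive j CF (Logic.I : setT y).
by move=> y; exact: Ck_open_continuous (Ck_open_partial j CF) Logic.I.
Qed.

(** For each [y] the difference quotient is the value of P' at an intermediate time, close to P' t y
    uniformly over the compact box; [mean_norm_le] then does the work of dominated convergence. *)
Lemma is_derive_mean (P P' : R -> 'rV[R]_n -> R) (t : R) :
  {near t, forall s : R, forall y, box y -> is_derive s 1 (P ^~ y) (P' s y)} ->
  (forall y, box y -> P' p.1 p.2 @[p --> (t, y)] --> P' t y) ->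
  {near t, forall s : R, bounded_on_box (P s)} -> bounded_on_box (P' t) ->
  is_derive t 1 (fun s => I (P s)) (I (P' t)).
Proof.
move=> dP cP bP bP'; apply: is_derive_cvg; apply/cvgrPdist_le => e e0.
have := compact_uniform_cvg compact_box cP e0.
move=> /(filterI dP)/(filterI bP)/nbhs_ballP[r /= r0 rP].
have bPt : bounded_on_box (P t) by have [] := rP _ (ballxx t r0).
apply: filterS2 (dnbhs0_lt r0) (nbhs_dnbhs_neq (0 : R)) => /= h hr h0.
have in_ball (s : R) : 0 <= s <= 1 -> ball t r (t + s * h).
  move=> /andP[s0 s1]; rewrite -ball_normE /ball_ /= opprD addrA subrr sub0r normrN.
  by rewrite normrM (ger0_norm s0); apply: le_lt_trans hr; rewrite ler_piMl.
have bPh : bounded_on_box (P (h + t)).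
  have := in_ball 1; rewrite mul1r addrC => /(_ _)/rP[]//; first by rewrite ler01 lexx.
pose Q y := (h : R)^-1 * P (h + t) y + (- h^-1) * P t y.
have bQ : bounded_on_box Q by apply: bounded_on_boxD; exact: bounded_on_boxZ.
rewrite [_ *: _](_ : _ = I Q); last first.
  rewrite mean_linear//; last exact: bounded_on_boxZ.
  by rewrite meanZ// mulNr -mulrBr [h *: 1]mulr1.
have -> : I (P' t) - I Q = - I (fun y => -1 * P' t y + Q y).
  by rewrite (mean_linear (-1) bP' bQ); ring.
rewrite normrN.
apply: mean_norm_le => y yB.
have dPy s : 0 <= s <= 1 -> is_derive s 1 (fun s => P (t + s * h) y)
    (P' (t + s * h) y * h).
  move=> s01; have [_ [/(_ y yB) dPs _]] := rP _ (in_ball s s01).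
  apply: (@is_derive1_chain _ (P ^~ y) (fun s => t + s * h)) => //.
  by derive_pointwise; ring.
have [s s01 Ps] := MVT_le ler01 dPy.
rewrite mul1r mul0r addr0 subr0 mulr1 (addrC t) in Ps.
have [_ [_ /(_ y yB)/ltW]] := rP _ (in_ball s s01).
rewrite /Q; suff -> : -1 * P' t y + ((h : R)^-1 * P (h + t) y + - h^-1 * P t y) =
  P' (t + s * h) y - P' t y by [].
have -> : P (h + t) y = P' (t + s * h) y * h + P t y by rewrite -Ps; ring.
by field.
Qed.

End MeanTheory.

(** * Radial means *)

Section Weights.
Context {R : realType} {n : nat}.
Implicit Types (f g w : 'rV[R]_n -> R) (x y z c : 'rV[R]_n) (i j : 'I_n)
  (U : set 'rV[R]_n) (k : nat).

Local Notation e_ i := (delta_mx ord0 i : 'rV[R]_n).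

Definition sqnorm y : R := \sum_(i < n) y ord0 i ^+ 2.

Lemma is_derive_coord x v i : is_derive x v (fun y => y ord0 i) (v ord0 i).
Proof.
rewrite -(addr0 x) -(scale0r v); apply/is_derive_lineP.
under eq_fun do rewrite !mxE; derive_pointwise; ring.
Qed.

Lemma partial_coord i j x : partial i (fun y => y ord0 j) x = (j == i)%:R.
Proof.
by have [_ ] := is_derive_coord x (e_ i) j; rewrite /partial => ->; rewrite mxE eqxx.
Qed.

Lemma Ck_open_coord k U i : Ck_open k U (fun y => y ord0 i).
Proof.
case: k => [|k]; split=> //; try by move=> x _; exact: coord_continuous.
move=> j; split=> [x _|]; first by have [] := is_derive_coord x (e_ j) i.
have -> : partial j (fun y => y ord0 i) = fun=> (i == j)%:R.
  by apply/funext => x; rewrite partial_coord.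
exact: Ck_open_const.
Qed.

Lemma Ck_open_sqnorm k U : open U -> Ck_open k U sqnorm.
Proof.
move=> oU; apply: Ck_open_sum => // i.
by apply: Ck_open_mul => //; exact: Ck_open_coord.
Qed.

Lemma is_derive_sqnorm x i : is_derive x (e_ i) sqnorm (2 * x ord0 i).
Proof.
have -> : 2 * x ord0 i = \sum_(j < n) ((j == i)%:R * x ord0 j + x ord0 j * (j == i)%:R).
  rewrite (bigD1 i)//= eqxx mul1r mulr1 big1 ?addr0 => [|j /negPf->]; first by ring.
  by rewrite mul0r mulr0 addr0.
apply: is_derive_sumr => j; have := is_derive_coord x (e_ i) j.
by rewrite mxE eqxx => dj; exact: is_derive_mul.
Qed.

Lemma is_derive1_continuous (p : R -> R) (t d : R) : is_derive t 1 p d ->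
  {for t, continuous p}.
Proof. by move=> [dp _]; exact/differentiable_continuous/derivable1_diffP. Qed.

Lemma Ck_open_comp (p p' : R -> R) k U f : open U ->
  (forall x, U x -> is_derive (f x) 1 p (p' (f x))) ->
  Ck_open k U (fun x => p' (f x)) -> Ck_open k.+1 U f ->
  Ck_open k.+1 U (fun x => p (f x)).
Proof.
move=> oU dp Cp' Cf.
have dpf x i : U x ->
    is_derive x (e_ i) (fun x => p (f x)) (p' (f x) * partial i f x).
  by move=> Ux; apply: is_derive_chain; [exact: dp|exact: Ck_open_is_derive Cf Ux].
split=> [x Ux|i].
  apply: continuous_comp; first exact: Ck_open_continuous Cf Ux.
  exact: is_derive1_continuous (dp x Ux).
split=> [x Ux|]; first by have [] := dpf x i Ux.
have := Ck_open_mul oU Cp' (Ck_open_partial i Cf).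
by apply: eq_Ck_open => // x; rewrite inE => Ux; have [_ <-] := dpf x i Ux.
Qed.

Let continuous_affine x (t : R) : continuous (fun y => x + t *: y).
Proof.
move=> y; apply: (@continuousD _ _ _ (cst x) ( *:%R t)).
  exact: cst_continuous.
exact: scaler_continuous.
Qed.

Lemma open_affine U x (t : R) : open U -> open [set y | U (x + t *: y)].
Proof. by move=> oU; apply: open_comp oU => y _; exact: continuous_affine. Qed.

Lemma is_derive_affine g x y i (t d : R) : is_derive (x + t *: y) (e_ i) g d ->
  is_derive y (e_ i) (fun y => g (x + t *: y)) (t * d).
Proof.
move=> dg; rewrite -(addr0 y) -(scale0r (e_ i)); apply/is_derive_lineP.
have -> : (fun s : R => g (x + t *: (y + s *: e_ i))) =
    (fun s => g ((x + t *: y) + (t * s) *: e_ i)).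
  by apply/funext => s; rewrite scalerDr scalerA addrA.
rewrite mulrC.
apply: (@is_derive1_chain _ (fun s => g (x + t *: y + s *: e_ i)) (fun s => t * s)).
  by apply: is_derive_line; rewrite mulr0 scale0r addr0.
by derive_pointwise; ring.
Qed.

Lemma Ck_open_affine k U g x (t : R) : open U -> Ck_open k U g ->
  Ck_open k [set y | U (x + t *: y)] (fun y => g (x + t *: y)).
Proof.
move=> oU; elim: k g => [|k IH] g Cg.
  split=> // y Uy; apply: continuous_comp; first exact: continuous_affine.
  exact: Ck_open_continuous Cg Uy.
have dg y i : U (x + t *: y) ->
    is_derive y (e_ i) (fun y => g (x + t *: y)) (t * partial i g (x + t *: y)).
  by move=> Uy; apply: is_derive_affine; exact: Ck_open_is_derive Cg Uy.
split=> [y Uy|i].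
  apply: continuous_comp; first exact: continuous_affine.
  exact: Ck_open_continuous Cg Uy.
split=> [y Uy|]; first by have [] := dg y i Uy.
have oV := @open_affine U x t oU.
have := Ck_open_mul oV (@Ck_open_const _ _ k _ t) (IH _ (Ck_open_partial i Cg)).
by apply: eq_Ck_open => // y; rewrite inE => Uy; have [_ <-] := dg y i Uy.
Qed.

Lemma Ck_open_subset k U V g : U `<=` V -> Ck_open k V g -> Ck_open k U g.
Proof.
move=> UV; elim: k g => [|k IH] g [cV dV]; split=> //; try by move=> x /UV/cV.
move=> i; have [dVi CVi] := dV i.
by split; [move=> x /UV/dVi|exact: IH].
Qed.

Lemma Ck_openU k U V g : Ck_open k U g -> Ck_open k V g -> Ck_open k (U `|` V) g.
Proof.
elim: k g => [|k IH] g [cU dU] [cV dV]; split=> //.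
- by move=> x [/cU|/cV].
- by move=> x [/cU|/cV].
- move=> i; have [dUi CUi] := dU i; have [dVi CVi] := dV i.
  by split; [move=> x [/dUi|/dVi]|exact: IH].
Qed.

End Weights.

Section WeightedMeans.
Context {R : realType} {n : nat} {I : ('rV[R]_n -> R) -> R} (meanI : is_mean I).
Variables (U S : set 'rV[R]_n) (x : 'rV[R]_n) (D : set R).
Hypotheses (oU : open U) (cS : closed S) (oD : open D).
Hypothesis Sbox : forall y j, S y -> `|y ord0 j| < 3.
Hypothesis SU : forall t y, D t -> S y -> U (x + t *: y).
Implicit Types (f g w : 'rV[R]_n -> R) (y : 'rV[R]_n) (i j : 'I_n) (t : R).

Local Notation e_ i := (delta_mx ord0 i : 'rV[R]_n).

Let near_off_S y : ~ S y -> \near y, ~ S y.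
Proof. by move=> Sy; apply: open_nbhs_nbhs; split=> //; exact: closed_openC. Qed.

(** On [S] the argument of [g] lies in [U]. Off the closed set [S] the product vanishes in a whole
    neighbourhood, whatever [g] does outside [U]. *)
Lemma cvg_weighted g w t y : D t -> Ck_open 0 U g -> continuous w ->
  (forall y, ~ S y -> w y = 0) ->
  g (x + p.1 *: p.2) * w p.2 @[p --> (t, y)] --> g (x + t *: y) * w y.
Proof.
move=> Dt Cg cw w0; have [Sy|Sy] := pselect (S y).
  have hfst : p.1 @[p --> (t, y)] --> t by exact: cvg_fst.
  have hsnd : p.2 @[p --> (t, y)] --> y by exact: cvg_snd.
  have haff : x + p.1 *: p.2 @[p --> (t, y)] --> x + t *: y.
    by apply: cvgD; [exact: cvg_cst|exact: cvgZ].
  apply: cvgM; last exact: (cvg_comp _ _ hsnd (cw y)).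
  exact: (cvg_comp _ _ haff (Ck_open_continuous Cg (SU Dt Sy))).
rewrite w0// mulr0; apply: cvg_near_cst.
exists (setT, ~` S); first by split; [exact: filterT|exact: near_off_S].
by move=> -[s z] /= [_ Sz]; rewrite w0// mulr0.
Qed.

Lemma continuous_weighted g w t : D t -> Ck_open 0 U g -> continuous w ->
  (forall y, ~ S y -> w y = 0) -> continuous (fun y => g (x + t *: y) * w y).
Proof.
move=> Dt Cg cw w0 y; have h := cvg_weighted (y := y) Dt Cg cw w0.
have h2 : (t, z) @[z --> y] --> (t, y).
  move=> A [[B C] /= [Bt Cy] BCA]; apply: filterS Cy => z Cz.
  by apply: BCA; split => //; exact: nbhs_singleton.
exact: cvg_trans (cvg_comp _ _ h2 h).
Qed.

Lemma bounded_weighted g w t : D t -> Ck_open 0 U g -> continuous w ->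
  (forall y, ~ S y -> w y = 0) -> bounded_on_box (fun y => g (x + t *: y) * w y).
Proof.
move=> Dt Cg cw w0; apply: bounded_on_box_continuous => y _.
exact: continuous_weighted.
Qed.

Lemma is_derive_weighted_mean g w t : D t -> Ck_open 1 U g ->
  continuous w -> (forall y, ~ S y -> w y = 0) ->
  is_derive t 1 (fun t => I (fun y => g (x + t *: y) * w y))
    (\sum_(i < n) I (fun y => partial i g (x + t *: y) * (y ord0 i * w y))).
Proof.
move=> Dt Cg cw w0.
have cyw i : continuous (fun y => y ord0 i * w y).
  by move=> y; apply: continuousM; [exact: coord_continuous|exact: cw].
have yw0 i y : ~ S y -> y ord0 i * w y = 0 by move=> /w0 ->; rewrite mulr0.
have Cg0 := Ck_openW Cg.
have near_D : {near t, forall s : R, D s} by apply: open_nbhs_nbhs.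
have bP i : bounded_on_box (fun y => partial i g (x + t *: y) * (y ord0 i * w y)).
  exact: (bounded_weighted Dt (Ck_open_partial i Cg) (cyw i) (yw0 i)).
rewrite -mean_sum//.
apply: (@is_derive_mean _ _ _ meanI (fun t y => g (x + t *: y) * w y)
  (fun t y => \sum_(i < n) partial i g (x + t *: y) * (y ord0 i * w y))).
- apply: filterS near_D => s Ds y _; have [Sy|Sy] := pselect (S y); last first.
    have -> : (fun t => g (x + t *: y) * w y) = fun=> 0.
      by apply/funext => r; rewrite w0// mulr0.
    rewrite big1 => [|i _]; first exact: is_derive_const.
    by rewrite yw0// mulr0.
  have dg := is_derive_line (is_derive_gradient y oU Cg (SU Ds Sy)).
  apply: is_derive_eq (is_derive_mul dg (is_derive_const (w y) s 1)) _.
  by rewrite mulr0 addr0 mulr_suml; apply: eq_bigr => i _; ring.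
- move=> y _; apply: cvg_big => [|i _]; first exact: add_continuous.
  by apply: (cvg_weighted Dt (Ck_open_partial i Cg) (cyw i)); exact: yw0.
- by apply: filterS near_D => s Ds; exact: bounded_weighted.
- exact: bounded_on_box_sum.
Qed.

(** Two open sets cover the space: the points mapped into [U], where both factors are regular, and
    the complement of [S], where the product is zero. *)
Lemma Ck_open_weighted k g w t : D t -> Ck_open k U g -> Ck_open k setT w ->
  (forall y, ~ S y -> w y = 0) -> Ck_open k setT (fun y => g (x + t *: y) * w y).
Proof.
move=> Dt Cg Cw w0.
have oV := @open_affine _ _ U x t oU.
have -> : setT = [set y | U (x + t *: y)] `|` ~` S.
  apply/esym; rewrite -subTset => y _; have [Sy|Sy] := pselect (S y); [left|by right].
  exact: SU.
apply: Ck_openU.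
  apply: Ck_open_mul => //; first exact: Ck_open_affine.
  by apply: Ck_open_subset Cw.
apply: eq_Ck_open (@Ck_open_const _ _ k (~` S) 0); first exact: closed_openC.
by move=> y; rewrite inE => Sy; rewrite w0// mulr0.
Qed.

(* The divergence theorem for the compactly supported field [g w e_j]. *)
Lemma mean_divergence g w t j : D t -> Ck_open 1 U g -> Ck_open 1 setT w ->
  (forall y, ~ S y -> w y = 0) ->
  t * I (fun y => partial j g (x + t *: y) * w y) +
    I (fun y => g (x + t *: y) * partial j w y) = 0.
Proof.
move=> Dt Cg Cw w0.
have pw0 y : ~ S y -> partial j w y = 0.
  move=> Sy; rewrite /partial (near_eq_derive _ (g := cst 0)) ?derive_cst//.
  by apply: filterS (near_off_S Sy) => z; exact: w0.
have cw : continuous w by move=> y; exact: Ck_open_continuous Cw Logic.I.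
have cpw : continuous (partial j w).
  by move=> y; exact: Ck_open_continuous (Ck_open_partial j Cw) Logic.I.
rewrite -mean_linear//; last first.
- by apply: bounded_weighted => //; exact: Ck_openW.
- by apply: bounded_weighted => //; exact: Ck_open_partial.
rewrite -[RHS](mean_partial meanI (j := j) (Ck_open_weighted Dt Cg Cw w0)) => [|y y3].
  congr I; apply/funext => y; apply/esym.
  have [Sy|Sy] := pselect (S y); last first.
    rewrite pw0// w0// !mulr0 addr0 /partial (near_eq_derive _ (g := cst 0)) ?derive_cst//.
    by apply: filterS (near_off_S Sy) => z Sz; rewrite w0// mulr0.
  have dg := is_derive_affine (Ck_open_is_derive j Cg (SU Dt Sy)).
  have [_ dgw] := is_derive_mul dg (Ck_open_is_derive j Cw (Logic.I : setT y)).
  by apply: etrans dgw _; ring.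
have [Sy|Sy] := pselect (S y); last by rewrite w0// mulr0.
by move: y3; rewrite leNgt Sbox.
Qed.

Section Radial.
Variables (p p' : R -> R).
Hypotheses (dp : forall r : R, is_derive r 1 p (p' r)) (cp' : continuous p').
Hypothesis p0 : forall y, ~ S y -> p (sqnorm y) = 0.

Let P y := p (sqnorm y).

Let CP : Ck_open 1 setT P.
Proof.
apply: (Ck_open_comp (p' := p')) => //; first exact: openT.
  split=> // y _; apply: continuous_comp; last exact: cp'.
  exact: Ck_open_continuous (Ck_open_sqnorm 0 openT) Logic.I.
by apply: Ck_open_sqnorm; exact: openT.
Qed.

Let CyP i : Ck_open 1 setT (fun y => y ord0 i * P y).
Proof. by apply: Ck_open_mul CP; [exact: openT|exact: Ck_open_coord]. Qed.

Let CyyP i j : Ck_open 1 setT (fun y => y ord0 i * (y ord0 j * P y)).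
Proof. by apply: Ck_open_mul (CyP j); [exact: openT|exact: Ck_open_coord]. Qed.

Let yP0 i y : ~ S y -> y ord0 i * P y = 0.
Proof. by move=> Sy; rewrite /P p0// mulr0. Qed.

Let yyP0 i j y : ~ S y -> y ord0 i * (y ord0 j * P y) = 0.
Proof. by move=> Sy; rewrite yP0// mulr0. Qed.

Let partial_yyP i j l y : partial l (fun y => y ord0 i * (y ord0 j * P y)) y =
  (i == l)%:R * (y ord0 j * P y) +
  y ord0 i * ((j == l)%:R * P y + y ord0 j * (p' (sqnorm y) * (2 * y ord0 l))).
Proof.
have dy k : is_derive y (e_ l) (fun y => y ord0 k) (k == l)%:R.
  by have := is_derive_coord y (e_ l) k; rewrite mxE eqxx.
by have [_ <-] := is_derive_mul (dy i)
  (is_derive_mul (dy j) (is_derive_chain (dp _) (is_derive_sqnorm y l))).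
Qed.

Let cont w : Ck_open 1 setT w -> continuous w.
Proof. by move=> Cw y; exact: Ck_open_continuous Cw Logic.I. Qed.

(* The rotation fields [y_i d_j - y_j d_i] are divergence free and annihilate
   radial functions; applied to [y_i d_j f] and summed over [i, j] they express
   [|y|^2 Delta f] through radial derivatives. *)
Lemma radial_mean_laplacian f : Ck_open 2 U f ->
  exists M1 M2 : R -> R, forall t, D t ->
  [/\ is_derive t 1 (fun t => I (fun y => f (x + t *: y) * p (sqnorm y))) (M1 t),
      is_derive t 1 M1 (M2 t) &
      t * M2 t + (n%:R - 1) * M1 t =
      t * I (fun y => laplacian f (x + t *: y) * (sqnorm y * p (sqnorm y)))].
Proof.
move=> Cf; have Cpf j := Ck_open_partial j Cf.
pose C j t := I (fun y => partial j f (x + t *: y) * (y ord0 j * P y)).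
pose A i j t := I (fun y =>
  partial j (partial j f) (x + t *: y) * (y ord0 i * (y ord0 i * P y))).
pose B i j t := I (fun y =>
  partial i (partial j f) (x + t *: y) * (y ord0 i * (y ord0 j * P y))).
exists (fun t => \sum_(j < n) C j t), (fun t => \sum_(j < n) \sum_(i < n) B i j t) => t Dt.
split.
- exact: is_derive_weighted_mean Dt (Ck_openW Cf) (cont CP) p0.
- apply: is_derive_sumr => j.
  exact: is_derive_weighted_mean Dt (Cpf j) (cont (CyP j)) (@yP0 j).
(* The terms with p' in the divergences of y_i^2 P e_j and y_i y_j P e_i cancel, and their
   difference is (delta_ij - 1) y_j P. Summing over [i] produces the coefficient 1 - n of the first
   derivative. *)
have ABC i j : t * A i j t - t * B i j t + ((i == j)%:R - 1) * C j t = 0.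
  have hA := mean_divergence j Dt (Cpf j) (CyyP i i) (@yyP0 i i).
  have hB := mean_divergence i Dt (Cpf j) (CyyP i j) (@yyP0 i j).
  rewrite -/(A i j t) in hA; rewrite -/(B i j t) in hB.
  have bC : bounded_on_box (fun y => partial j f (x + t *: y) * (y ord0 j * P y)).
    exact: bounded_weighted Dt (Ck_openW (Cpf j)) (cont (CyP j)) (@yP0 j).
  have bB : bounded_on_box (fun y => partial j f (x + t *: y) *
      partial i (fun y => y ord0 i * (y ord0 j * P y)) y).
    apply: bounded_weighted Dt (Ck_openW (Cpf j)) _ _.
      by move=> y; exact: Ck_open_continuous (Ck_open_partial i (CyyP i j)) Logic.I.
    move=> y Sy; rewrite /partial (near_eq_derive _ (g := cst 0)) ?derive_cst//.
    by apply: filterS (near_off_S Sy) => z; exact: yyP0.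
  have : I (fun y => partial j f (x + t *: y) *
      partial j (fun y => y ord0 i * (y ord0 i * P y)) y) =
      ((i == j)%:R - 1) * C j t + I (fun y => partial j f (x + t *: y) *
      partial i (fun y => y ord0 i * (y ord0 j * P y)) y).
    rewrite -(mean_linear meanI _ bC bB); congr I; apply/funext => y.
    by rewrite !partial_yyP !eqxx; have [->|_] := eqVneq i j; rewrite /=; ring.
  lra.
have AE : I (fun y => laplacian f (x + t *: y) * (sqnorm y * p (sqnorm y))) =
    \sum_(j < n) \sum_(i < n) A i j t.
  have bA i j : bounded_on_box (fun y =>
      partial j (partial j f) (x + t *: y) * (y ord0 i * (y ord0 i * P y))).
    exact: bounded_weighted Dt (Ck_open_partial j (Cpf j)) (cont (CyyP i i)) (@yyP0 i i).
  under eq_bigr do rewrite -mean_sum//.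
  rewrite -mean_sum//; last by move=> j; exact: bounded_on_box_sum.
  congr I; apply/funext => y; rewrite /laplacian mulr_suml; apply: eq_bigr => j _.
  rewrite {1}/sqnorm mulr_suml mulr_sumr; apply: eq_bigr => i _.
  by rewrite /P; ring.
rewrite AE; apply/eqP; rewrite -subr_eq0 -oppr_eq0; apply/eqP.
transitivity (\sum_(j < n) \sum_(i < n)
   (t * A i j t - t * B i j t + ((i == j)%:R - 1) * C j t)); last first.
  by rewrite big1// => j _; rewrite big1.
rewrite !mulr_sumr opprB opprD addrA -!sumrN -!big_split/=; apply: eq_bigr => j _.
rewrite !big_split/= sumrN !mulr_sumr; congr (_ - _ + _).
rewrite -mulr_suml sumrB sumr_const card_ord (bigD1 j)//= eqxx big1 ?addr0.
  by rewrite -mulNr opprB.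
by move=> i /negPf ->.
Qed.

End Radial.

End WeightedMeans.

Section Translation.
Context {R : realType} {n : nat} {I : ('rV[R]_n -> R) -> R} (meanI : is_mean I).
Implicit Types (F G : 'rV[R]_n -> R) (y z v : 'rV[R]_n) (t : R).

(** The derivative in [t] of the mean of F (y + t z) is a combination of means of partial
    derivatives. These vanish while the translated support stays in the cube, hence the condition at
    every [t] in [0, 1]. *)
Lemma mean_translate F (z : 'rV[R]_n) : Ck_open 1 setT F ->
  (forall (t : R) y j, 0 <= t <= 1 -> 3 <= `|y ord0 j| -> F (y + t *: z) = 0) ->
  I (fun y => F (y + z)) = I F.
Proof.
move=> CF F0.
have dF y t v : is_derive (y + t *: v) v F (\sum_(j < n) v ord0 j * partial j F (y + t *: v)).
  exact: is_derive_gradient openT CF Logic.I.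
have cF G t : Ck_open 0 setT G -> continuous (fun y => G (y + t *: z)).
  move=> CG; have [cG _] := @Ck_open_affine _ _ 0 setT G (t *: z) 1 openT CG.
  have -> : (fun y => G (y + t *: z)) = fun y => G (t *: z + 1 *: y).
    by apply/funext => y; rewrite scale1r addrC.
  by move=> y; exact: cG.
have bF G t : Ck_open 0 setT G -> bounded_on_box (fun y => G (y + t *: z)).
  by move=> CG; apply: bounded_on_box_continuous => y _; exact: cF.
have dI (t : R) : 0 <= t <= 1 -> is_derive t 1 (fun t => I (fun y => F (y + t *: z))) 0.
  move=> t01; have I0 j : I (fun y => partial j F (y + t *: z)) = 0.
    pose Ft y := F (t *: z + 1 *: y).
    have FtE : Ft = fun y => F (y + t *: z).
      by apply/funext => y; rewrite /Ft scale1r addrC.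
    have CFt : Ck_open 1 setT Ft by exact: (@Ck_open_affine _ _ 1 setT F (t *: z) 1 openT CF).
    rewrite -[RHS](mean_partial meanI (j := j) CFt) => [|y y3].
      congr I; apply/funext => y.
      have [_ ] := is_derive_affine (Ck_open_is_derive (x := t *: z + 1 *: y) j CF Logic.I).
      by rewrite mul1r scale1r addrC => <-.
    by rewrite FtE (F0 _ _ _ t01 y3).
  have -> : 0 = I (fun y => \sum_(j < n) z ord0 j * partial j F (y + t *: z)).
    rewrite mean_sum// => [|j]; last exact/bounded_on_boxZ/bF/Ck_open_partial.
    rewrite big1// => j _; rewrite meanZ ?I0 ?mulr0//.
    exact/bF/Ck_open_partial.
  apply: (@is_derive_mean _ _ _ meanI (fun t y => F (y + t *: z))
    (fun t y => \sum_(j < n) z ord0 j * partial j F (y + t *: z))).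
  - by apply: (@filterE _ (nbhs t)) => s y _; exact: is_derive_line.
  - move=> y _; apply: cvg_big => [|j _]; first exact: add_continuous.
    have hfst : p.1 @[p --> (t, y)] --> t by exact: cvg_fst.
    have hsnd : p.2 @[p --> (t, y)] --> y by exact: cvg_snd.
    have haff : p.2 + p.1 *: z @[p --> (t, y)] --> y + t *: z.
      by apply: cvgD => //; exact: cvgZr_tmp.
    apply: cvgMr.
    exact: (cvg_comp _ _ haff (Ck_open_continuous (Ck_open_partial j CF) Logic.I)).
  - by apply: (@filterE _ (nbhs t)) => s; exact/bF/Ck_openW.
  - by apply: bounded_on_box_sum => j; exact/bounded_on_boxZ/bF/Ck_open_partial.
have [c _] := MVT_le ler01 dI.
rewrite mul0r => /eqP; rewrite subr_eq0 scale1r => /eqP ->.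
by congr I; apply/funext => y; rewrite scale0r addr0.
Qed.

End Translation.

(** * Convexity, cut-off functions and a mean inequality *)

Section AuxiliaryInequalities.
Context {R : realType}.
Implicit Types (a b q r s t : R).

(** The left side is the tangent at [b] of the convex function a^q; averaged with [b] equal to the
    mean it gives Jensen's inequality. For q > 1 this is Young's inequality for [a] and b^(q -
    1). *)
Lemma powR_tangent a b q : 0 < a -> 0 < b -> q = 0 \/ 1 <= q ->
  q * b `^ (q - 1) * a - (q - 1) * b `^ q <= a `^ q.
Proof.
move=> a0 b0 [->|]; first by rewrite !mul0r !powRr0; lra.
rewrite le_eqVlt => /predU1P[<-|q1].
  by rewrite subrr powRr0 !mul1r mul0r subr0 powRr1// ltW.
have q0 : 0 < q by lra.
have q10 : 0 < q - 1 by lra.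
have := @conjugate_powR R a (b `^ (q - 1)) q (q / (q - 1)) (ltW a0) (powR_ge0 _ _) q0.
rewrite divr_gt0// -powRrM => /(_ isT).
have -> : (q - 1) * (q / (q - 1)) = q by field; lra.
have -> : q^-1 + (q / (q - 1))^-1 = 1 by field; apply/andP; split; lra.
move=> /(_ erefl).
have -> : a `^ q / q + b `^ q / (q / (q - 1)) = (a `^ q + (q - 1) * b `^ q) / q.
  by field; apply/andP; split; lra.
rewrite ler_pdivlMr//; lra.
Qed.

Definition pospart_sq s := Num.max 0 s ^+ 2.

Lemma pospart_sq_ge0 s : 0 <= pospart_sq s. Proof. exact: sqr_ge0. Qed.

Lemma pospart_sq_le0 s : s <= 0 -> pospart_sq s = 0.
Proof. by move=> s0; rewrite /pospart_sq max_l// expr0n. Qed.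

Lemma pospart_sq_le s t : s <= t -> pospart_sq s <= pospart_sq t.
Proof.
move=> st; have st' : Num.max 0 s <= Num.max 0 t by rewrite ge_max !le_max lexx st orbT.
by apply: lerXn2r => //; rewrite nnegrE le_max lexx.
Qed.

Lemma is_derive_pospart_sq s : is_derive s 1 pospart_sq (2 * Num.max 0 s).
Proof.
have [s0|s0|->] := ltgtP s 0.
- rewrite mulr0.
  apply: near_eq_is_derive (is_derive_const 0 s 1).
  by apply: filterS (lt_nbhsl s0) => t /ltW/pospart_sq_le0.
- apply: (@near_eq_is_derive _ _ _ (fun s => s * s)).
    by apply: filterS (lt_nbhsr s0) => t t0; rewrite /pospart_sq max_r ?expr2// ltW.
  by derive_pointwise; ring.
rewrite mulr0; apply: is_derive_cvg; apply/cvgrPdist_le => e e0.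
apply: filterS2 (dnbhs0_lt e0) (nbhs_dnbhs_neq (0 : R)) => /= h he h0.
rewrite addr0 [h *: 1]mulr1 sub0r normrN (pospart_sq_le0 (lexx 0)) subr0.
rewrite normrZ normfV ler_pdivrMl ?normr_gt0//.
rewrite /pospart_sq; have [h_le|h_gt] := leP h 0.
  by rewrite expr0n normr0 mulr_ge0// ltW.
by rewrite normrX expr2 ler_wpM2l// ltW.
Qed.

Lemma continuous_pospart : continuous (fun s => 2 * Num.max 0 s).
Proof.
move=> s; apply: cvgMr.
by apply: (@continuous_max _ _ (cst 0) id s); [exact: cst_continuous|exact: cvg_id].
Qed.

Lemma is_derive_exprS N t : is_derive t 1 (fun t => t ^+ N.+1) (N.+1%:R * t ^+ N).
Proof.
elim: N => [|N IH].
  by rewrite expr0 mulr1; under eq_fun do rewrite expr1; exact: is_derive_var.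
under eq_fun do rewrite exprS.
apply: is_derive_eq (is_derive_mul (is_derive_var t) IH) _.
by rewrite -[in RHS](addn1 N.+1) natrD !exprS; ring.
Qed.

(* [F] and [G] stand for the spherical means of a function and of its
   Laplacian: if the bilaplacian is nonpositive then [(F t - F 0) / t ^ 2]
   decreases, hence [F (2 r) - F 0 <= 4 (F r - F 0)]. *)
Lemma superbiharmonic_mean_le (N : nat) (F F1 F2 G G1 G2 E : R -> R) r : 0 <= r ->
  (forall t, 0 <= t <= 2 * r ->
    [/\ is_derive t 1 F (F1 t), is_derive t 1 F1 (F2 t) &
        t * F2 t + N.+1%:R * F1 t = t * G t]) ->
  (forall t, 0 <= t <= 2 * r ->
    [/\ is_derive t 1 G (G1 t), is_derive t 1 G1 (G2 t),
        t * G2 t + N.+1%:R * G1 t = t * E t & E t <= 0]) ->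
  3 * F 0 <= 4 * F r - F (2 * r).
Proof.
move=> r0 hF hG.
have G1_le0 t : 0 < t -> t <= 2 * r -> G1 t <= 0.
  move=> t0 tr.
  have : t ^+ N.+1 * G1 t <= 0 ^+ N.+1 * G1 0.
    apply: (@is_derive_le0_le _ (fun t => t ^+ N.+1 * G1 t)
      (fun t => t ^+ N * (t * E t)) 0 t (ltW t0)) => s /andP[s0 st].
      have [_ dG1 <- _] := hG s (introT andP (conj s0 (le_trans st tr))).
      by apply: is_derive_eq (is_derive_mul (is_derive_exprS N s) dG1) _; rewrite exprS; ring.
    have [_ _ _ E0] := hG s (introT andP (conj s0 (le_trans st tr))).
    by rewrite mulr_ge0_le0 ?exprn_ge0// mulr_ge0_le0.
  by rewrite expr0n mul0r pmulr_rle0// exprn_gt0.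
have G_noninc s t : 0 < s -> s <= t -> t <= 2 * r -> G t <= G s.
  move=> s0 st tr; apply: (is_derive_le0_le st (f' := G1)) => u /andP[su ut].
    have u2 : 0 <= u <= 2 * r by apply/andP; split; lra.
    by have [] := hG u u2.
  by apply: G1_le0; lra.
have dF2 t : 0 <= t <= r -> is_derive t 1 (fun t => F (2 * t)) (F1 (2 * t) * 2) /\
    is_derive t 1 (fun t => F1 (2 * t)) (F2 (2 * t) * 2).
  move=> /andP[t0 tr]; have tr2 : 0 <= 2 * t <= 2 * r by apply/andP; split; lra.
  have [dF dF1 _] := hF _ tr2.
  have d2 : is_derive t 1 (fun t => 2 * t) 2 by derive_pointwise; ring.
  by split; [exact: is_derive1_chain dF d2|exact: is_derive1_chain dF1 d2].
have tr_2r t : 0 <= t <= r -> 0 <= t <= 2 * r.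
  by move=> /andP[t0 tr]; apply/andP; split; lra.
(* Combining the equations at [t] and 2 t, the derivative of t^(N + 1) (2 F1 t - F1 (2 t)) is 2 t^(N
   + 1) (G t - G (2 t)), nonnegative since [G] decreases; the power of [t] makes the function vanish
   at 0. *)
have Q_ge0 t : 0 < t -> t <= r -> F1 (2 * t) <= 2 * F1 t.
  move=> t0 tr.
  have : 0 ^+ N.+1 * (2 * F1 0 - F1 (2 * 0)) <= t ^+ N.+1 * (2 * F1 t - F1 (2 * t)).
    apply: (@is_derive_ge0_le _ (fun t => t ^+ N.+1 * (2 * F1 t - F1 (2 * t)))
      (fun t => 2 * t ^+ N.+1 * (G t - G (2 * t))) 0 t (ltW t0)) => s /andP[s0 st].
      have sr : 0 <= s <= r by rewrite s0 (le_trans st).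
      have [_ dF1 eF] := hF s (tr_2r s sr); have [_ dF12] := dF2 s sr.
      have s2r : 0 <= 2 * s <= 2 * r by apply/andP; split; lra.
      have [_ _ eF2] := hF _ s2r.
      apply: is_derive_eq (is_derive_mul (is_derive_exprS N s) (is_derive_add
        (is_derive_mul (is_derive_const 2 s 1) dF1) (is_derive_opp dF12))) _.
      rewrite exprS.
      have -> : 2 * (s * s ^+ N) * (G s - G (2 * s)) =
        s ^+ N * (2 * (s * G s) - 2 * s * G (2 * s)) by ring.
      by rewrite -eF -eF2; ring.
    have [s_eq0|s_neq0] := eqVneq s 0.
      by rewrite s_eq0 mulr0 subrr mulr0.
    have s_gt0 : 0 < s by rewrite lt_neqAle eq_sym s_neq0.
    rewrite mulr_ge0 ?mulr_ge0 ?exprn_ge0// subr_ge0; apply: G_noninc => //; lra.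
  by rewrite expr0n mul0r pmulr_rge0 ?exprn_gt0// subr_ge0.
have : 4 * F 0 - F (2 * 0) <= 4 * F r - F (2 * r).
  apply: (@is_derive_ge0_le _ (fun t => 4 * F t - F (2 * t))
    (fun t => 4 * F1 t - F1 (2 * t) * 2) 0 r r0) => s sr.
    have [dF _ _] := hF s (tr_2r s sr); have [dF_2 _] := dF2 s sr.
    apply: is_derive_eq (is_derive_add (is_derive_mul (is_derive_const 4 s 1) dF)
      (is_derive_opp dF_2)) _; ring.
  have [s_eq0|s_neq0] := eqVneq s 0.
    rewrite s_eq0 mulr0.
    have [_ _] := hF 0 (tr_2r 0 (introT andP (conj (lexx 0) r0))).
    rewrite !mul0r add0r => /eqP; rewrite mulf_eq0 pnatr_eq0/= => /eqP ->; lra.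
  have s_gt0 : 0 < s by rewrite lt_neqAle eq_sym s_neq0; case/andP: sr.
  by have := Q_ge0 s s_gt0 (proj2 (andP sr)); lra.
rewrite mulr0; lra.
Qed.

End AuxiliaryInequalities.

Section EuclideanGeometry.
Context {R : realType} {n : nat}.
Implicit Types (x y z : 'rV[R]_n) (t : R).

Lemma sqnorm_ge0 y : 0 <= sqnorm y.
Proof. by apply: sumr_ge0 => i _; exact: sqr_ge0. Qed.

Lemma sqnormZ t y : sqnorm (t *: y) = t ^+ 2 * sqnorm y.
Proof.
by rewrite /sqnorm mulr_sumr; apply: eq_bigr => i _; rewrite mxE exprMn.
Qed.

Lemma sqr_coord_le_sqnorm y i : y ord0 i ^+ 2 <= sqnorm y.
Proof. by rewrite /sqnorm (bigD1 i)//= lerDl sumr_ge0// => j _; exact: sqr_ge0. Qed.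

(** A triangle inequality for squares with a free parameter, which avoids square roots: the defect
    in each coordinate is (t x_i - y_i)^2 / t. *)
Lemma sqnormD_le t x y : 0 < t ->
  sqnorm (x + y) <= (1 + t) * sqnorm x + (1 + t^-1) * sqnorm y.
Proof.
move=> t0; rewrite /sqnorm !mulr_sumr -big_split/=; apply: ler_sum => i _.
rewrite mxE -subr_ge0.
have -> : (1 + t) * x ord0 i ^+ 2 + (1 + t^-1) * y ord0 i ^+ 2 -
    (x ord0 i + y ord0 i) ^+ 2 = (t * x ord0 i - y ord0 i) ^+ 2 / t by field; lra.
by rewrite divr_ge0 ?sqr_ge0// ltW.
Qed.

Lemma sqnormD_ge t x y : 0 < t ->
  (1 - t) * sqnorm x + (1 - t^-1) * sqnorm y <= sqnorm (x + y).
Proof.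
move=> t0; rewrite /sqnorm !mulr_sumr -big_split/=; apply: ler_sum => i _.
rewrite mxE -subr_ge0.
have -> : (x ord0 i + y ord0 i) ^+ 2 -
    ((1 - t) * x ord0 i ^+ 2 + (1 - t^-1) * y ord0 i ^+ 2) =
    (t * x ord0 i + y ord0 i) ^+ 2 / t by field; lra.
by rewrite divr_ge0 ?sqr_ge0// ltW.
Qed.

Lemma enorm_lt x (r : R) : 0 < r -> (enorm x < r) = (sqnorm x < r ^+ 2).
Proof.
move=> r0; rewrite -(@ltr_pXn2r _ 2)// ?nnegrE ?sqrtr_ge0 ?(ltW r0)//.
by rewrite sqr_sqrtr// sqnorm_ge0.
Qed.

Lemma continuous_sqnorm : continuous (@sqnorm R n).
Proof. by move=> y; exact: Ck_open_continuous (Ck_open_sqnorm 0 openT) Logic.I. Qed.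

Lemma closed_sqnorm_le (c : 'rV[R]_n) (r : R) : closed [set y | sqnorm (y - c) <= r].
Proof.
apply: (@closed_comp _ _ (fun y => sqnorm (y - c)) [set s | s <= r]); last exact: closed_le.
move=> y _; apply: continuous_comp; last exact: continuous_sqnorm.
by apply: continuousB; [exact: cvg_id|exact: cst_continuous].
Qed.

(** The positivity clause of [is_mean] only tests cubes; coordinates between sqrt (r / n) and sqrt
    (s / n) fit a cube into the given shell, and s <= 9 keeps it in the box. *)
Lemma cube_sqnorm (r s : R) : (0 < n)%N -> 0 <= r -> r < s -> s <= 9 ->
  exists c d : R, [/\ 0 <= c, c < d, d <= 3 &
    forall y, (forall i, c <= y ord0 i <= d) -> r <= sqnorm y <= s].
Proof.
move=> n0 r0 rs s9; have nR : 1 <= n%:R :> R by rewrite ler1n.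
have nR0 : 0 < n%:R :> R by lra.
have rn0 : 0 <= r / n%:R by rewrite divr_ge0// ltW.
have sn0 : 0 <= s / n%:R by rewrite divr_ge0// ltW//; lra.
exists (Num.sqrt (r / n%:R)), (Num.sqrt (s / n%:R)); split.
- exact: sqrtr_ge0.
- by rewrite ltr_sqrt ?ltr_pM2r ?invr_gt0// divr_gt0//; lra.
- rewrite -(@ger0_norm _ 3)// -sqrtr_sqr ler_sqrt// ler_pdivrMr//; nra.
move=> y yi; have sumE (u : R) : u = \sum_(i < n) u / n%:R.
  by rewrite sumr_const card_ord -[RHS]mulr_natr divfK// gt_eqF.
have c0 := sqrtr_ge0 (r / n%:R).
apply/andP; split; [rewrite (sumE r)|rewrite (sumE s)]; apply: ler_sum => i _;
  have /andP[ci di] := yi i.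
  by rewrite -(sqr_sqrtr rn0) lerXn2r// nnegrE (le_trans c0).
by rewrite -(sqr_sqrtr sn0) lerXn2r ?nnegrE ?sqrtr_ge0// (le_trans c0).
Qed.

End EuclideanGeometry.

Section RadialBilaplacian.
Context {R : realType} {n : nat} {I : ('rV[R]_n -> R) -> R} (meanI : is_mean I).
Variables (U S : set 'rV[R]_n) (x : 'rV[R]_n) (D : set R).
Hypotheses (oU : open U) (cS : closed S) (oD : open D).
Hypothesis Sbox : forall y j, S y -> `|y ord0 j| < 3.
Hypothesis SU : forall t y, D t -> S y -> U (x + t *: y).
Variables (p p' : R -> R).
Hypotheses (dp : forall r : R, is_derive r 1 p (p' r)) (cp' : continuous p').
Hypothesis p0 : forall y, ~ S y -> p (sqnorm y) = 0.

(** [radial_mean_laplacian] replaces the profile p (s) by s p (s), which is again C^1 with the same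
    support, so it applies a second time, to the Laplacian of [f]. *)
Lemma radial_mean_bilaplacian (f : 'rV[R]_n -> R) : Ck_open 4 U f ->
  let F t := I (fun y => f (x + t *: y) * p (sqnorm y)) in
  let G t := I (fun y => laplacian f (x + t *: y) * (sqnorm y * p (sqnorm y))) in
  let E t := I (fun y => bilaplacian f (x + t *: y) *
                         (sqnorm y * (sqnorm y * p (sqnorm y)))) in
  exists F1 F2 G1 G2 : R -> R, forall t, D t ->
  [/\ is_derive t 1 F (F1 t), is_derive t 1 F1 (F2 t) &
      t * F2 t + (n%:R - 1) * F1 t = t * G t] /\
  [/\ is_derive t 1 G (G1 t), is_derive t 1 G1 (G2 t) &
      t * G2 t + (n%:R - 1) * G1 t = t * E t].
Proof.
move=> Cf F G E.
have [F1 [F2 hF]] := radial_mean_laplacian meanI oU cS oD Sbox SU dp cp' p0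
  (Ck_openW (Ck_openW Cf)).
pose q (r : R) := r * p r; pose q' (r : R) := p r + r * p' r.
have dq (r : R) : is_derive r 1 q (q' r).
  apply: is_derive_eq (is_derive_mul (is_derive_var r) (dp r)) _.
  by rewrite /q' mul1r.
have cp : continuous p by move=> r; exact: is_derive1_continuous (dp r).
have cq' : continuous q'.
  by move=> r; apply: cvgD; [exact: cp|apply: cvgM; [exact: cvg_id|exact: cp']].
have q0 y : ~ S y -> q (sqnorm y) = 0 by move=> Sy; rewrite /q p0// mulr0.
have [G1 [G2 hG]] := radial_mean_laplacian meanI oU cS oD Sbox SU dq cq' q0
  (Ck_open_laplacian oU Cf).
by exists F1, F2, G1, G2 => t Dt; split; [exact: hF|exact: hG].
Qed.

End RadialBilaplacian.

(** * Nonexistence *)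

Section PositiveSolution.
Context {R : realType} {n : nat} {I : ('rV[R]_n -> R) -> R} (meanI : is_mean I).
Variables (U : set 'rV[R]_n) (v : 'rV[R]_n -> R) (r0 : R).
Hypotheses (n2 : (2 <= n)%N) (r0_gt0 : 0 < r0) (oU : open U) (Cv : Ck_open 4 U v).
Hypothesis Uv : forall x, r0 ^+ 2 <= sqnorm x -> U x.
Hypothesis v_gt0 : forall x, r0 ^+ 2 <= sqnorm x -> 0 < v x.
Hypothesis bv_le0 : forall x, r0 ^+ 2 <= sqnorm x -> bilaplacian v x <= 0.
Implicit Types (x y z : 'rV[R]_n) (j : 'I_n) (r s t : R).

(* Weights in the variable [s = |y|^2], supported in [1 <= s <= 4] and
   [s <= 1 / 16]; squaring the positive part makes them C^1. *)
Definition shell s := pospart_sq ((s - 1) * (4 - s)).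
Definition shell' s := 2 * Num.max 0 ((s - 1) * (4 - s)) * (5 - 2 * s).
Definition bump s := pospart_sq (16^-1 - s).
Definition bump' s := 2 * Num.max 0 (16^-1 - s) * -1.

Lemma is_derive_shell s : is_derive s 1 shell (shell' s).
Proof.
apply: is_derive1_chain (is_derive_pospart_sq _) _.
derive_pointwise; ring.
Qed.

Lemma is_derive_bump s : is_derive s 1 bump (bump' s).
Proof.
apply: is_derive1_chain (is_derive_pospart_sq _) _.
derive_pointwise; ring.
Qed.

Lemma continuous_shell' : continuous shell'.
Proof.
move=> s.
have d1 : is_derive s 1 (fun s => (s - 1) * (4 - s)) (5 - 2 * s).
  by derive_pointwise; ring.
have d2 : is_derive s 1 (fun s : R => 5 - 2 * s) (- 2) by derive_pointwise; ring.
apply: continuousM (is_derive1_continuous d2).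
exact: (continuous_comp (is_derive1_continuous d1) (@continuous_pospart R _)).
Qed.

Lemma continuous_bump' : continuous bump'.
Proof.
move=> s; have d : is_derive s 1 (fun s : R => 16^-1 - s) (- 1) by derive_pointwise; ring.
apply: continuousM _ (@cst_continuous _ _ (-1 : R) s).
exact: (continuous_comp (is_derive1_continuous d) (@continuous_pospart R _)).
Qed.

Lemma shell_ge0 s : 0 <= shell s. Proof. exact: pospart_sq_ge0. Qed.
Lemma bump_ge0 s : 0 <= bump s. Proof. exact: pospart_sq_ge0. Qed.

Lemma shell_sqnorm_eq0 y : ~ (1 <= sqnorm y <= 4) -> shell (sqnorm y) = 0.
Proof.
move=> /negP; rewrite negb_and -!ltNge => /orP[] h; apply: pospart_sq_le0; nra.
Qed.

Lemma bump_sqnorm_eq0 y : ~ (sqnorm (y - 0) <= 16^-1) -> bump (sqnorm y) = 0.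
Proof.
by rewrite subr0 => /negP; rewrite -ltNge => h; apply: pospart_sq_le0; lra.
Qed.

Lemma closed_shell : closed [set y : 'rV[R]_n | 1 <= sqnorm y <= 4].
Proof.
have -> : [set y : 'rV[R]_n | 1 <= sqnorm y <= 4] = @sqnorm R n @^-1` `[1, 4]%classic.
  by apply/funext => y /=; rewrite in_itv.
by apply: closed_comp => [y _|]; [exact: continuous_sqnorm|exact: itv_closed].
Qed.

Lemma sqnorm_lt9 y j : sqnorm y < 9 -> `|y ord0 j| < 3.
Proof.
move=> y9; rewrite -(@ltr_pXn2r _ 2)// ?nnegrE// real_normK ?num_real//.
by apply: le_lt_trans (sqr_coord_le_sqnorm y j) _; lra.
Qed.

Lemma continuous_shell_sqnorm : continuous (fun y : 'rV[R]_n => shell (sqnorm y)).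
Proof.
move=> y; apply: (continuous_comp (@continuous_sqnorm _ _ y)).
exact: is_derive1_continuous (is_derive_shell _).
Qed.

Lemma continuous_bump_sqnorm : continuous (fun y : 'rV[R]_n => bump (sqnorm y)).
Proof.
move=> y; apply: (continuous_comp (@continuous_sqnorm _ _ y)).
exact: is_derive1_continuous (is_derive_bump _).
Qed.

Lemma Ck_open_bump : Ck_open 1 setT (fun y : 'rV[R]_n => bump (sqnorm y)).
Proof.
apply: (Ck_open_comp (p' := bump') openT) => [y _||]; first exact: is_derive_bump.
- split=> // y _; apply: (continuous_comp (@continuous_sqnorm _ _ y)).
  exact: continuous_bump'.
- by apply: Ck_open_sqnorm; exact: openT.
Qed.

Let n_gt0 : (0 < n)%N. Proof. exact: leq_trans n2. Qed.

Let shell_box y j : 1 <= sqnorm y <= 4 -> `|y ord0 j| < 3.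
Proof. by move=> /andP[_ y4]; apply: sqnorm_lt9; lra. Qed.

Lemma mean_shell_gt0 : 0 < I (fun y => shell (sqnorm y)).
Proof.
have [//|||c [d [c0 cd d3 ycd]]] := @cube_sqnorm R n (3 / 2) 3 n_gt0; try lra.
have c3 : -3 <= c by apply: (le_trans _ c0); lra.
apply: (mean_gt0 meanI (e := 1 / 4) _ _ c3 cd d3) => //.
- by apply: bounded_on_box_continuous => y _; exact: continuous_shell_sqnorm.
- by move=> y _; exact: shell_ge0.
move=> y /ycd /andP[y1 y2].
have h : (1 / 2 : R) <= (sqnorm y - 1) * (4 - sqnorm y) by nra.
apply: le_trans (pospart_sq_le h); rewrite /pospart_sq max_r ?expr2; lra.
Qed.

Lemma mean_bump_gt0 : 0 < I (fun y => bump (sqnorm y)).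
Proof.
have [//|||c [d [c0 cd d3 ycd]]] := @cube_sqnorm R n 0 (1 / 32) n_gt0; try lra.
have c3 : -3 <= c by apply: (le_trans _ c0); lra.
apply: (mean_gt0 meanI (e := (1 / 32) ^+ 2) _ _ c3 cd d3) => //.
- by apply: bounded_on_box_continuous => y _; exact: continuous_bump_sqnorm.
- by move=> y _; exact: bump_ge0.
move=> y /ycd /andP[y1 y2].
have h : (1 / 32 : R) <= 16^-1 - sqnorm y by lra.
by apply: le_trans (pospart_sq_le h); rewrite /pospart_sq max_r//; lra.
Qed.

Let D0 : set R := [set t | r0 < t].

Let oD0 : open D0. Proof. exact: open_gt. Qed.

Let shell_U t y : D0 t -> 1 <= sqnorm y <= 4 -> r0 ^+ 2 <= sqnorm (0 + t *: y).
Proof.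
rewrite /D0/= => r0t /andP[y1 _]; rewrite add0r sqnormZ.
have r0' := r0_gt0; have : r0 ^+ 2 <= t ^+ 2 by nra.
by move=> /le_trans; apply; rewrite ler_peMr ?sqr_ge0.
Qed.

Definition shell_mean r := I (fun y => v (0 + r *: y) * shell (sqnorm y)).

Let C0v : Ck_open 0 U v.
Proof. by split=> // x Ux; exact: Ck_open_continuous Cv Ux. Qed.

Let bounded_shell g r : D0 r -> Ck_open 0 U g ->
  bounded_on_box (fun y => g (0 + r *: y) * shell (sqnorm y)).
Proof.
move=> Dr Cg; apply: (bounded_weighted closed_shell _ Dr Cg continuous_shell_sqnorm).
  by move=> t y Dt /= Sy; exact/Uv/shell_U.
exact: shell_sqnorm_eq0.
Qed.

Lemma shell_mean_gt0 r : r0 < r -> 0 < shell_mean r.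
Proof.
move=> r0r.
have [//|||c [d [c0 cd d3 ycd]]] := @cube_sqnorm R n (3 / 2) 3 n_gt0; try lra.
have c3 : -3 <= c by apply: (le_trans _ c0); lra.
pose K : set 'rV[R]_n := [set y | forall i, (fun=> `[c, d]%classic) i (y ord0 i)].
have cK : compact K.
  apply: (rV_compact (T := R) (A := fun=> `[c, d]%classic)) => i.
  exact: segment_compact.
have KS y : K y -> 3 / 2 <= sqnorm y <= 3.
  by move=> Ky; apply: ycd => i; have := Ky i; rewrite /= in_itv.
have KU y : K y -> r0 ^+ 2 <= sqnorm (0 + r *: y).
  by move=> /KS/andP[y1 y2]; apply: shell_U => //; apply/andP; split; lra.
have [y Ky|y Ky|e e0 Ke] := @compact_gt0_continuous R _ K (fun y => v (0 + r *: y)) cK.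
- have [cv _] := @Ck_open_affine _ _ 0 U v 0 r oU C0v.
  exact/cv/Uv/KU.
- exact/v_gt0/KU.
apply: (mean_gt0 meanI (e := e * (1 / 4)) _ _ c3 cd d3) => //.
- exact: bounded_shell.
- move=> y _; have [Sy|Sy] := pselect (1 <= sqnorm y <= 4).
    by rewrite mulr_ge0 ?shell_ge0// ltW// v_gt0// shell_U.
  by rewrite shell_sqnorm_eq0// mulr0.
- by rewrite mulr_gt0//; lra.
move=> y yi; have Ky : K y by move=> i; rewrite /= in_itv; exact: yi.
have /andP[y1 y2] := KS y Ky.
apply: ler_pM; [exact: ltW|lra|exact: Ke|].
have h : (1 / 2 : R) <= (sqnorm y - 1) * (4 - sqnorm y) by nra.
apply: le_trans (pospart_sq_le h); rewrite /pospart_sq max_r ?expr2; lra.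
Qed.

(* The mean value inequality for functions with [Delta^2 v <= 0] in the ball of
   radius [r / 2] about [r *: z], followed by a comparison of that ball with the
   shell of radii [r] and [2 * r]. *)
Lemma pointwise_le_shell_mean r z : 2 * r0 <= r -> sqnorm z = 9 / 4 ->
  3 * I (fun y => bump (sqnorm y)) * v (r *: z) <= 4 * shell_mean r.
Proof.
move=> r0r z94; have r0' := r0_gt0; have r_gt0 : 0 < r by lra.
pose S : set 'rV[R]_n := [set y | sqnorm (y - 0) <= 16^-1].
(* An open interval containing the scales 0, [r] and 2 r compared below. For |y| <= 1 / 4 and |t| <
   3 r one has |t y| <= 3 r / 4, half of |r z| = 3 r / 2, so r z + t y stays outside the ball of
   radius [r0]. *)
pose D : set R := `]- (3 * r), 3 * r[%classic.
have SD t y : D t -> S y -> r0 ^+ 2 <= sqnorm (r *: z + t *: y).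
  rewrite /D /S /= in_itv/= subr0 => /andP[t1 t2] y16.
  have i2 : 0 < 2^-1 :> R by lra.
  have := sqnormD_ge (r *: z) (t *: y) i2; rewrite !sqnormZ z94 invrK.
  have : t ^+ 2 <= 9 * r ^+ 2 by nra.
  have := sqnorm_ge0 y; have : 4 * r0 ^+ 2 <= r ^+ 2 by nra.
  have := sqr_ge0 t.
  move=> h1 h2 h3 h4.
  have : t ^+ 2 * sqnorm y <= 9 * r ^+ 2 * 16^-1 by apply: ler_pM.
  have := sqr_ge0 r; lra.
have SU t y : D t -> S y -> U (r *: z + t *: y) by move=> Dt Sy; exact/Uv/SD.
have oD : open D by exact: interval_open.
have Sbox y j : S y -> `|y ord0 j| < 3.
  by rewrite /S/= subr0 => Sy; apply: sqnorm_lt9; lra.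
have := radial_mean_bilaplacian meanI oU (@closed_sqnorm_le R n 0 16^-1) oD Sbox SU
  is_derive_bump continuous_bump' bump_sqnorm_eq0 Cv.
move=> /= [F1 [F2 [G1 [G2 hFG]]]].
have nE : n%:R - 1 = (n.-2.+1)%:R :> R.
  by rewrite -(natrB _ n_gt0) subn1; congr (_%:R); case: (n) n2 => [|[]].
have Dt t : 0 <= t <= 2 * r -> D t.
  by move=> /andP[t1 t2]; rewrite /D /= in_itv/=; apply/andP; split; lra.
have bP t g : D t -> Ck_open 0 U g ->
    bounded_on_box (fun y => g (r *: z + t *: y) * bump (sqnorm y)).
  move=> Dt' Cg.
  exact: (bounded_weighted (@closed_sqnorm_le R n 0 16^-1) SU Dt' Cg
    continuous_bump_sqnorm bump_sqnorm_eq0).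
rewrite nE in hFG.
have bumpy : continuous (fun y : 'rV[R]_n => sqnorm y * (sqnorm y * bump (sqnorm y))).
  move=> y; have cs := @continuous_sqnorm R n y.
  exact: continuousM cs (continuousM cs (@continuous_bump_sqnorm y)).
have E_le0 t : D t -> I (fun y => bilaplacian v (r *: z + t *: y) *
    (sqnorm y * (sqnorm y * bump (sqnorm y)))) <= 0.
  move=> Dt'; rewrite -(mean0 meanI); apply: (mean_le meanI).
  - have CE : Ck_open 0 U (bilaplacian v) by do 2 apply: Ck_open_laplacian => //.
    apply: (bounded_weighted (@closed_sqnorm_le R n 0 16^-1) SU Dt' CE bumpy) => y Sy.
    by rewrite bump_sqnorm_eq0// !mulr0.
  - exact: bounded_on_box_const.
  move=> y _; have [Sy|Sy] := pselect (S y); last by rewrite bump_sqnorm_eq0// !mulr0.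
  apply: mulr_le0_ge0; first exact/bv_le0/SD.
  exact: mulr_ge0 (sqnorm_ge0 y) (mulr_ge0 (sqnorm_ge0 y) (bump_ge0 _)).
pose E t := I (fun y => bilaplacian v (r *: z + t *: y) *
  (sqnorm y * (sqnorm y * bump (sqnorm y)))).
have hG t : 0 <= t <= 2 * r -> [/\ is_derive t 1 (fun t => I (fun y =>
      laplacian v (r *: z + t *: y) * (sqnorm y * bump (sqnorm y)))) (G1 t),
    is_derive t 1 G1 (G2 t), t * G2 t + n.-2.+1%:R * G1 t = t * E t & E t <= 0].
  by move=> /Dt Dt'; have [_ [dG dG1 eG]] := hFG t Dt'; split=> //; exact: E_le0.
have := superbiharmonic_mean_le (ltW r_gt0) (fun t tr => proj1 (hFG t (Dt t tr))) hG.
have -> : I (fun y => v (r *: z + 0 *: y) * bump (sqnorm y)) =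
    v (r *: z) * I (fun y => bump (sqnorm y)).
  rewrite -(meanZ meanI); last first.
    by apply: bounded_on_box_continuous => y _; exact: continuous_bump_sqnorm.
  by congr I; apply/funext => y; rewrite scale0r addr0.
have D2r : D (2 * r) by apply: Dt; apply/andP; split; lra.
have Dr : D r by apply: Dt; apply/andP; split; lra.
have F2r_ge0 : 0 <= I (fun y => v (r *: z + (2 * r) *: y) * bump (sqnorm y)).
  apply: (mean_ge0 meanI); first exact: bP.
  move=> y _; have [Sy|Sy] := pselect (S y); last by rewrite bump_sqnorm_eq0// mulr0.
  by rewrite mulr_ge0 ?bump_ge0// ltW// v_gt0// SD.
suff : I (fun y => v (r *: z + r *: y) * bump (sqnorm y)) <= shell_mean r by lra.
(* The mean at scale [r] about r z becomes one about the origin by translating the weight: its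
   support is now the ball of radius 1 / 4 about [z], inside the shell. *)
pose F y := v (0 + r *: y) * bump (sqnorm (y - z)).
pose Sz : set 'rV[R]_n := [set y | sqnorm (y - z) <= 16^-1].
have zSz y : Sz y -> 25 / 16 <= sqnorm y <= 49 / 16.
  rewrite /Sz/= => yz.
  (* 1 / 6 is the ratio of the radii 1 / 4 and 3 / 2; with it the two estimates give the exact range
     from (5 / 4)^2 to (7 / 4)^2. *)
  have h6 : 0 < 6^-1 :> R by lra.
  have := sqnormD_ge z (y - z) h6; have := sqnormD_le z (y - z) h6.
  rewrite subrKC z94 invrK; have := sqnorm_ge0 (y - z).
  by move=> *; apply/andP; split; lra.
have bump_z y : ~ Sz y -> bump (sqnorm (y - z)) = 0.
  by move=> /negP; rewrite -ltNge => h; apply: pospart_sq_le0; lra.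
have SzU t y : [set t | r0 < t] t -> Sz y -> U (0 + t *: y).
  move=> r0t /zSz/andP[y1 y2]; apply/Uv/shell_U => //.
  by apply/andP; split; lra.
have Cbump : Ck_open 1 setT (fun y => bump (sqnorm (y - z))).
  have -> : (fun y => bump (sqnorm (y - z))) = fun y => bump (sqnorm (- z + 1 *: y)).
    by apply/funext => y; rewrite scale1r addrC.
  exact: (@Ck_open_affine _ _ 1 setT _ (- z) 1 openT Ck_open_bump).
have r0r1 : r0 < r by lra.
have CF : Ck_open 1 setT F.
  apply: (Ck_open_weighted oU (@closed_sqnorm_le R n z 16^-1) SzU r0r1) => //.
  by do 3 apply: Ck_openW.
have -> : (fun y => v (r *: z + r *: y) * bump (sqnorm y)) = fun y => F (y + z).
  by apply/funext => y; rewrite /F addrK add0r scalerDr addrC.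
rewrite (mean_translate meanI CF) => [|t y j /andP[t0 t1] y3]; last first.
  rewrite /F bump_z ?mulr0// => Sy.
  have := le_trans (sqr_coord_le_sqnorm _ j) Sy; rewrite !mxE.
  have := sqr_coord_le_sqnorm z j; rewrite z94.
  move: (y ord0 j) (z ord0 j) y3 => a b a3 b2.
  have : - (3 / 2) <= b <= 3 / 2 by apply/andP; split; nra.
  move=> /andP[b3 b4]; have : - (3 / 2) <= (1 - t) * b <= 3 / 2.
    by apply/andP; split; nra.
  move=> /andP[tb1 tb2].
  have -> : a + t * b - b = a - (1 - t) * b by ring.
  move: a3; rewrite ler_normr => /orP[] a3; nra.
apply: (mean_le meanI).
- apply: bounded_on_box_continuous => y _; exact: Ck_open_continuous CF Logic.I.
- exact: bounded_shell.
move=> y _; have [Sy|Sy] := pselect (Sz y).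
  have /andP[y1 y2] := zSz y Sy.
  rewrite ler_wpM2l//; first by rewrite ltW// v_gt0// shell_U//; apply/andP; split; lra.
  have h : 16^-1 <= (sqnorm y - 1) * (4 - sqnorm y) by nra.
  apply: le_trans (pospart_sq_le h); apply: pospart_sq_le.
  by have := sqnorm_ge0 (y - z); lra.
rewrite /F bump_z// mulr0; have [Sy1|Sy1] := pselect (1 <= sqnorm y <= 4).
  by rewrite mulr_ge0 ?shell_ge0// ltW// v_gt0// shell_U.
by rewrite shell_sqnorm_eq0// mulr0.
Qed.

(** * From the differential inequality to the radial system *)

Section PowerInequality.
Variable lam : R.
Hypotheses (lamN1 : -1 <= lam) (mlam : (n%:R - 2) * lam <= (n%:R - 2) + 4).
Hypothesis v_ineq : forall x, r0 ^+ 2 <= sqnorm x -> v x `^ lam <= - bilaplacian v x.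

Let mass := I (fun y => shell (sqnorm y)).
(** Since expR t >= 1 + t, radii beyond expR T exceed 4 r0, which meets the condition 2 r0 <= r of
    [pointwise_le_shell_mean]. *)
Let T := 4 * r0 + 1.
Let V t := shell_mean (expR t).
Let E r := I (fun y => bilaplacian v (0 + r *: y) *
  (sqnorm y * (sqnorm y * shell (sqnorm y)))).
Let z t := t * expR (2 * t).

Let T_ge1 : 1 <= T. Proof. by have := r0_gt0; rewrite /T; lra. Qed.

Let expRT t : T <= t -> 4 * r0 < expR t.
Proof. by have := expR_ge1Dx t; have := r0_gt0; rewrite /T; lra. Qed.

Let z_gt0 t : T <= t -> 0 < z t.
Proof. by move=> Tt; rewrite mulr_gt0 ?expR_gt0// (lt_le_trans _ Tt)// (lt_le_trans ltr01). Qed.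

Let D0_expR t : T <= t -> D0 (expR t).
Proof. by move=> /expRT; have := r0_gt0; rewrite /D0/=; lra. Qed.

Let V_gt0 t : T <= t -> 0 < V t.
Proof. by move=> /D0_expR; exact: shell_mean_gt0. Qed.

Let bounded_E r : D0 r -> bounded_on_box (fun y => bilaplacian v (0 + r *: y) *
  (sqnorm y * (sqnorm y * shell (sqnorm y)))).
Proof.
move=> Dr; have CE : Ck_open 0 U (bilaplacian v) by do 2 apply: Ck_open_laplacian => //.
have cw : continuous (fun y : 'rV[R]_n => sqnorm y * (sqnorm y * shell (sqnorm y))).
  move=> y; have cs := @continuous_sqnorm R n y.
  exact: continuousM cs (continuousM cs (@continuous_shell_sqnorm y)).
apply: (bounded_weighted closed_shell _ Dr CE cw) => [t y Dt Sy|y Sy].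
  exact/Uv/shell_U.
by rewrite shell_sqnorm_eq0// !mulr0.
Qed.

Let E_le0 t : T <= t -> E (expR t) <= 0.
Proof.
move=> /D0_expR Dt; rewrite -(mean0 meanI); apply: (mean_le meanI).
- exact: bounded_E.
- exact: bounded_on_box_const.
move=> y _; have [Sy|Sy] := pselect (1 <= sqnorm y <= 4); last first.
  by rewrite shell_sqnorm_eq0// !mulr0.
apply: mulr_le0_ge0; first exact/bv_le0/shell_U.
exact: mulr_ge0 (sqnorm_ge0 y) (mulr_ge0 (sqnorm_ge0 y) (shell_ge0 _)).
Qed.

(** A point x of the shell is r z with |z| = 3 / 2 and r = 2 |x| / 3, as [pointwise_le_shell_mean]
    requires. The delay from [T] to T + 1 makes r >= 2 expR t / 3 at least expR T. *)
Let v_upper_bound : (exists2 C, 0 < C & forall t, T <= t -> V t <= C * z t) ->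
  exists2 C, 0 < C & forall t y, T + 1 <= t -> 1 <= sqnorm y <= 4 ->
    v (0 + expR t *: y) <= C * z t.
Proof.
move=> [C C0 VC]; have := mean_bump_gt0; set m2 := I _ => m2_gt0.
exists ((4 / (3 * m2)) * C * 4).
  by rewrite !mulr_gt0 ?invr_gt0 ?mulr_gt0.
move=> t y Tt /andP[y1 y4]; have T1 := T_ge1; have et := expR_gt0 t.
pose rho := Num.sqrt (sqnorm y).
have rho2 : rho ^+ 2 = sqnorm y by rewrite sqr_sqrtr// sqnorm_ge0.
have rho0 : 0 <= rho by exact: sqrtr_ge0.
have rho_ge1 : 1 <= rho by nra.
have rho_le2 : rho <= 2 by nra.
pose r := 2 / 3 * (expR t * rho).
have r_ge : 2 / 3 * expR t <= r by rewrite /r; nra.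
have r_le : r <= 4 / 3 * expR t by rewrite /r; nra.
have r_gt0 : 0 < r by lra.
have e1 : 2 <= expR 1 :> R by have := expR_ge1Dx (1 : R); lra.
have rT : expR T <= r.
  apply: le_trans r_ge; have : expR (T + 1) <= expR t by rewrite ler_expR.
  by rewrite expRD; have := expR_gt0 T; nra.
have lnr_ge : T <= ln r by rewrite -ler_expR lnK.
have lnr_le : ln r <= 2 * t.
  rewrite -ler_expR lnK//; apply: le_trans r_le _.
  have -> : 2 * t = t + t by ring.
  rewrite expRD; have : expR 1 <= expR t by rewrite ler_expR; lra.
  by move=> h; nra.
(* Both ln r <= 2 t and r^2 <= 2 expR (2 t) cost a factor 2. *)
have z_lnr : z (ln r) <= 4 * z t.
  rewrite /z; have -> : 2 * ln r = ln r + ln r by ring.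
  have -> : 2 * t = t + t by ring.
  rewrite !expRD lnK//.
  have : r * r <= 2 * (expR t * expR t) by nra.
  move=> rr; apply: (@le_trans _ _ ((2 * t) * (2 * (expR t * expR t)))); last lra.
  by apply: ler_pM => //; [lra|rewrite mulr_ge0// ltW].
have r2r0 : 2 * r0 <= r.
  by have := expRT (lexx T); have := r0_gt0; lra.
have z94 : sqnorm (r^-1 *: (expR t *: y)) = 9 / 4.
  rewrite !sqnormZ -rho2 /r; field; apply/andP; split; apply: lt0r_neq0; lra.
have := pointwise_le_shell_mean r2r0 z94.
rewrite scalerA divff ?gt_eqF// scale1r -/m2.
have -> : shell_mean r = V (ln r) by rewrite /V lnK.
have VL := VC _ lnr_ge => h; rewrite add0r.
have : C * z (ln r) <= C * (4 * z t) by rewrite ler_pM2l.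
move=> Cz; rewrite -(ler_pM2l (_ : 0 < 3 * m2)) ?mulr_gt0//.
have -> : 3 * m2 * (4 / (3 * m2) * C * 4 * z t) = 4 * (C * (4 * z t)) by field; lra.
lra.
Qed.

(** Pointwise v^lam >= P v^q, because lam - q <= 0 and v <= C z. Then v^q is bounded below by its
    tangent at the weighted mean b = V / mass, whose integral against [shell] is mass b^q. The
    weight s^2 shell in [E] only helps, as s >= 1. *)
Let H_lower_bound C q t : 0 < C -> lam <= q -> q = 0 \/ 1 <= q -> T <= t ->
  (forall y, 1 <= sqnorm y <= 4 -> v (0 + expR t *: y) <= C * z t) ->
  C `^ (lam - q) * mass * (mass^-1) `^ q * z t `^ (lam - q) * V t `^ q <= - E (expR t).
Proof.
move=> C0 lq q01 Tt vC; have Dt := D0_expR Tt.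
have mass_gt0 : 0 < mass by exact: mean_shell_gt0.
have Vt := V_gt0 Tt; have zt := z_gt0 Tt.
pose b := V t / mass; have b0 : 0 < b by rewrite divr_gt0.
pose P := (C * z t) `^ (lam - q).
have P0 : 0 <= P by exact: powR_ge0.
have bmass : bounded_on_box (fun y : 'rV[R]_n => shell (sqnorm y)).
  by apply: bounded_on_box_continuous => y _; exact: continuous_shell_sqnorm.
have bV := bounded_shell Dt C0v.
have -> : C `^ (lam - q) * mass * (mass^-1) `^ q * z t `^ (lam - q) * V t `^ q =
    (P * (q * b `^ (q - 1))) * V t + (P * - ((q - 1) * b `^ q)) * mass.
  have Vb : V t = b * mass by rewrite divfK// gt_eqF.
  have bq : b `^ q = b * b `^ (q - 1).
    by rewrite -{2}(powRr1 (ltW b0)) -powRD ?(gt_eqF b0) ?implybT//; congr (_ `^ _); ring.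
  have bqE : b `^ q = V t `^ q * (mass^-1) `^ q by rewrite powRM ?invr_ge0// ltW.
  have PE : P = C `^ (lam - q) * z t `^ (lam - q).
    by rewrite /P powRM ?(ltW C0) ?(ltW zt).
  rewrite PE.
  transitivity (C `^ (lam - q) * z t `^ (lam - q) * mass * b `^ q).
    by rewrite bqE; ring.
  by rewrite [X in _ = _ * X + _]Vb [in RHS]bq [in LHS]bq; ring.
have -> : - E (expR t) = I (fun y => -1 * (bilaplacian v (0 + expR t *: y) *
    (sqnorm y * (sqnorm y * shell (sqnorm y))))).
  by rewrite (meanZ meanI) ?mulN1r//; exact: bounded_E.
rewrite -[X in _ + X](meanZ meanI _ bmass) -(mean_linear meanI _ bV); last first.
  exact: bounded_on_boxZ.
apply: (mean_le meanI).
- by apply: bounded_on_boxD; exact: bounded_on_boxZ.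
- by apply: bounded_on_boxZ; exact: bounded_E.
move=> y _; have [Sy|Sy] := pselect (1 <= sqnorm y <= 4); last first.
  by rewrite shell_sqnorm_eq0// !mulr0 addr0.
have xr0 := shell_U Dt Sy; set x := 0 + _ in xr0 *.
have vx := v_gt0 xr0.
have h1 : P * (q * b `^ (q - 1) * v x - (q - 1) * b `^ q) <= - bilaplacian v x.
  apply: le_trans (v_ineq xr0).
  have -> : v x `^ lam = v x `^ (lam - q) * v x `^ q.
    by rewrite -powRD ?(gt_eqF vx) ?implybT//; congr (_ `^ _); ring.
  apply: (@le_trans _ _ (P * v x `^ q)).
    by rewrite ler_wpM2l// powR_tangent.
  rewrite ler_wpM2r ?powR_ge0//; apply: le0_ler_powR => //; first by rewrite subr_le0.
  exact: vC.
have sh := shell_ge0 (sqnorm y); have /andP[s1 _] := Sy.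
have bx : 0 <= - bilaplacian v x by rewrite oppr_ge0 bv_le0.
have h2 : - bilaplacian v x * shell (sqnorm y) <=
    - bilaplacian v x * (sqnorm y * (sqnorm y * shell (sqnorm y))).
  by rewrite ler_wpM2l// mulrA ler_peMl//; nra.
have h3 := ler_wpM2r sh h1.
lra.
Qed.

(** In the variable t = ln r the operator r^2 F'' + (n - 1) r F' has the constant-coefficient form
    d^2/dt^2 + m d/dt with m = n - 2, which gives the equations of the radial system. *)
Lemma positive_solution_absurd : False.
Proof.
have SU t y : D0 t -> 1 <= sqnorm y <= 4 -> U (0 + t *: y).
  by move=> Dt Sy; exact/Uv/shell_U.
have := radial_mean_bilaplacian meanI oU closed_shell oD0 shell_box SU
  is_derive_shell continuous_shell' shell_sqnorm_eq0 Cv.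
move=> /= [F1 [F2 [G1 [G2 hFG]]]].
pose m : R := n%:R - 2.
have m0 : 0 <= m by rewrite subr_ge0 ler_nat.
pose L r := I (fun y => laplacian v (0 + r *: y) * (sqnorm y * shell (sqnorm y))).
pose X t := expR t * F1 (expR t); pose W t := - L (expR t).
pose Y t := - (expR t * G1 (expR t)); pose H t := - E (expR t).
have e2 t : expR (2 * t) = expR t * expR t by rewrite -expRD; congr expR; ring.
have V' t : T <= t -> is_derive t 1 V (X t).
  move=> /D0_expR/hFG[[dF _ _] _].
  by apply: is_derive_eq (is_derive1_chain dF (is_derive_expR t)) _; rewrite mulrC.
have X' t : T <= t -> is_derive t 1 X (- m * X t - expR (2 * t) * W t).
  move=> /D0_expR/hFG[[_ dF1 eF] _].
  apply: is_derive_eq (is_derive_mul (is_derive_expR t)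
    (is_derive1_chain dF1 (is_derive_expR t))) _.
  have eF' : F2 (expR t) * expR t = expR t * L (expR t) - (n%:R - 1) * F1 (expR t).
    by rewrite -eF; ring.
  by rewrite e2 eF' /X /W /m; ring.
have W' t : T <= t -> is_derive t 1 W (Y t).
  move=> /D0_expR/hFG[_ [dG _ _]].
  by apply: is_derive_eq (is_derive_opp (is_derive1_chain dG (is_derive_expR t))) _;
    rewrite mulrC.
have Y' t : T <= t -> is_derive t 1 Y (- m * Y t + expR (2 * t) * H t).
  move=> /D0_expR/hFG[_ [_ dG1 eG]].
  apply: is_derive_eq (is_derive_opp (is_derive_mul (is_derive_expR t)
    (is_derive1_chain dG1 (is_derive_expR t)))) _.
  have eG' : G2 (expR t) * expR t = expR t * E (expR t) - (n%:R - 1) * G1 (expR t).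
    by rewrite -eG; ring.
  by rewrite e2 eG' /Y /H /m; ring.
have H0 t : T <= t -> 0 <= H t by move=> Tt; rewrite oppr_ge0 E_le0.
have [C C0 vC] := v_upper_bound (radial_V_le m0 T_ge1 V' X' W' Y' H0).
apply: (radial_system_absurd m0 T_ge1 V' X' W' Y' V_gt0 H0 lamN1 mlam).
move=> q lq q01; exists (C `^ (lam - q) * mass * (mass^-1) `^ q).
  by rewrite !mulr_gt0 ?powR_gt0 ?invr_gt0// mean_shell_gt0.
exists (T + 1); first by rewrite lerDl.
move=> t Tt; apply: H_lower_bound => //; first by apply: le_trans Tt; rewrite lerDl.
by move=> y; exact: vC.
Qed.

End PowerInequality.

End PositiveSolution.

(** * Existence *)

Section RadialPowers.
Context {R : realType} {n : nat}.
Implicit Types (f g : 'rV[R]_n -> R) (x : 'rV[R]_n) (a b c : R) (k : nat).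

Local Notation e_ i := (delta_mx ord0 i : 'rV[R]_n).

Definition punctured : set 'rV[R]_n := [set x | 0 < sqnorm x].

Lemma open_punctured : open punctured.
Proof.
apply: (@open_comp _ _ (@sqnorm R n) [set s | 0 < s]); last exact: open_gt.
by move=> x _; exact: continuous_sqnorm.
Qed.

Lemma Ck_open_powR k a : Ck_open k punctured (fun x => sqnorm x `^ a).
Proof.
have oP := open_punctured.
elim: k a => [|k IH] a.
  split=> // x Ux.
  exact: (continuous_comp (@continuous_sqnorm _ _ x)
    (is_derive1_continuous (is_derive1_powR a Ux))).
apply: (Ck_open_comp (p := fun s => s `^ a) (p' := fun s => a * s `^ (a - 1)) oP
  (fun x Ux => is_derive1_powR a Ux)).
- exact: (Ck_open_mul oP (@Ck_open_const _ _ k _ a) (IH (a - 1))).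
- exact: Ck_open_sqnorm.
Qed.

Lemma eq_laplacian (U : set 'rV[R]_n) f g x : open U -> {in U, f =1 g} -> U x ->
  laplacian f x = laplacian g x.
Proof.
move=> oU fg Ux; apply: eq_bigr => i _.
have pfg : {in U, partial i f =1 partial i g}.
  by move=> y; rewrite inE => Uy; exact: (eq_partial i oU fg Uy).
exact: (eq_partial i oU pfg Ux).
Qed.

Lemma laplacian_lin (U : set 'rV[R]_n) f g b c x : open U ->
  Ck_open 2 U f -> Ck_open 2 U g -> U x ->
  laplacian (fun x => b * f x + c * g x) x = b * laplacian f x + c * laplacian g x.
Proof.
move=> oU Cf Cg Ux.
have lin k f' g' i y : Ck_open k.+1 U f' -> Ck_open k.+1 U g' -> U y ->
    partial i (fun x => b * f' x + c * g' x) y = b * partial i f' y + c * partial i g' y.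
  move=> Cf' Cg' Uy.
  have [_ d] := is_derive_add
    (is_derive_mul (is_derive_const b y (e_ i)) (Ck_open_is_derive i Cf' Uy))
    (is_derive_mul (is_derive_const c y (e_ i)) (Ck_open_is_derive i Cg' Uy)).
  by apply: etrans d _; rewrite !mul0r !add0r.
rewrite /laplacian !mulr_sumr -big_split/=; apply: eq_bigr => i _.
have eqU : {in U, partial i (fun x => b * f x + c * g x) =1
    fun x => b * partial i f x + c * partial i g x}.
  by move=> y; rewrite inE => Uy; exact: lin Cf Cg Uy.
rewrite (eq_partial i oU eqU Ux).
exact: lin (Ck_open_partial i Cf) (Ck_open_partial i Cg) Ux.
Qed.

Lemma laplacian_powR a x : punctured x ->
  laplacian (fun x => sqnorm x `^ a) x =
  2 * a * (2 * a + n%:R - 2) * sqnorm x `^ (a - 1).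
Proof.
move=> Ux; have oP := open_punctured.
have d1 b y i : punctured y -> is_derive y (e_ i) (fun x => sqnorm x `^ b)
    (b * sqnorm y `^ (b - 1) * (2 * y ord0 i)).
  move=> Uy; apply: (is_derive_chain (p := fun s => s `^ b)); last exact: is_derive_sqnorm.
  exact: is_derive1_powR.
have eqU i : {in punctured, partial i (fun x => sqnorm x `^ a) =1
    fun x => a * sqnorm x `^ (a - 1) * (2 * x ord0 i)}.
  by move=> y; rewrite inE => Uy; have [_] := d1 a y i Uy.
have -> : sqnorm x `^ (a - 1) = sqnorm x * sqnorm x `^ (a - 1 - 1).
  rewrite -{2}(powRr1 (ltW Ux)) -powRD ?(gt_eqF Ux) ?implybT//.
  by congr (_ `^ _); ring.
rewrite /laplacian; transitivity (\sum_(i < n)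
    (4 * a * (a - 1) * sqnorm x `^ (a - 1 - 1) * x ord0 i ^+ 2 +
     2 * a * (sqnorm x * sqnorm x `^ (a - 1 - 1)))); last first.
  by rewrite big_split/= -mulr_sumr sumr_const card_ord -mulr_natl /sqnorm; ring.
apply: eq_bigr => i _; rewrite (eq_partial i oP (eqU i) Ux).
have dx : is_derive x (e_ i) (fun x => x ord0 i) 1.
  by have := is_derive_coord x (e_ i) i; rewrite mxE !eqxx.
have [_ d] := is_derive_mul
  (is_derive_mul (is_derive_const a x (e_ i)) (d1 (a - 1) x i Ux))
  (is_derive_mul (is_derive_const 2 x (e_ i)) dx).
apply: etrans d _.
have -> : sqnorm x `^ (a - 1) = sqnorm x * sqnorm x `^ (a - 1 - 1).
  rewrite -{2}(powRr1 (ltW Ux)) -powRD ?(gt_eqF Ux) ?implybT//.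
  by congr (_ `^ _); ring.
ring.
Qed.

(** Here b |x|^2 + c |x|^(2 a). The first term is written as a power so that [laplacian_powR] covers
    both; it is biharmonic, since its Laplacian has exponent 0. *)
Definition radial_profile b c a x := b * sqnorm x `^ 1 + c * sqnorm x `^ a.

Lemma bilaplacian_radial_profile b c a x : punctured x ->
  bilaplacian (radial_profile b c a) x =
  c * (2 * a * (2 * a + n%:R - 2) * (2 * a - 2) * (2 * a + n%:R - 4)) *
  sqnorm x `^ (a - 2).
Proof.
move=> Ux; have oP := open_punctured.
pose K1 := 2 * 1 * (2 * 1 + n%:R - 2) : R.
pose Ka := 2 * a * (2 * a + n%:R - 2).
have eqU : {in punctured, laplacian (radial_profile b c a) =1
    fun x => (b * K1) * sqnorm x `^ (1 - 1) + (c * Ka) * sqnorm x `^ (a - 1)}.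
  move=> y; rewrite inE => Uy.
  rewrite (laplacian_lin b c oP (Ck_open_powR 2 1) (Ck_open_powR 2 a) Uy).
  by rewrite !laplacian_powR// /K1 /Ka; ring.
rewrite /bilaplacian (eq_laplacian oP eqU Ux).
rewrite (laplacian_lin _ _ oP (Ck_open_powR 2 _) (Ck_open_powR 2 _) Ux).
rewrite !laplacian_powR// subrr mulr0 !mul0r mulr0 add0r /Ka.
have -> : a - 1 - 1 = a - 2 by ring.
ring.
Qed.

Lemma radial_profile_solution (lam r0 b c a : R) : 0 < r0 ->
  (forall q : R, r0 ^+ 2 <= q -> 0 < b * q + c * q `^ a) ->
  (forall q : R, r0 ^+ 2 <= q -> (b * q + c * q `^ a) `^ lam <=
    - (c * (2 * a * (2 * a + n%:R - 2) * (2 * a - 2) * (2 * a + n%:R - 4)) *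
       q `^ (a - 2))) ->
  exists v : 'rV[R]_n -> R, C4_positive_solution lam (~` eball0 (n := n) r0) v.
Proof.
move=> r0_gt0 pos ineq; exists (radial_profile b c a).
have oP := open_punctured.
have far x : (~` eball0 (n := n) r0) x -> r0 ^+ 2 <= sqnorm x.
  by rewrite /setC/= /eball0/= enorm_lt// => /negP; rewrite -leNgt.
have farP x : (~` eball0 (n := n) r0) x -> punctured x.
  by move=> /far; apply: lt_le_trans; rewrite exprn_gt0.
have profE x : radial_profile b c a x = b * sqnorm x + c * sqnorm x `^ a.
  by rewrite /radial_profile powRr1// sqnorm_ge0.
split=> [|x /far xr|x xr].
- exists punctured; split; [exact: oP|exact: farP|].
  exact: (Ck_open_add oP (Ck_open_mul oP (@Ck_open_const _ _ 4 _ b) (Ck_open_powR 4 1))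
    (Ck_open_mul oP (@Ck_open_const _ _ 4 _ c) (Ck_open_powR 4 a))).
- by rewrite profE pos.
- by rewrite bilaplacian_radial_profile ?profE ?ineq//; [exact: far|exact: farP].
Qed.

End RadialPowers.

Section Existence.
Context {R : realType}.
Implicit Types (lam r a q : R).

(* [A] is chosen so that [A `^ (lam - 1) = K * r `^ e]. *)
Lemma amplitude_exists lam (K e r : R) : 0 < K -> 0 <= e -> 0 < r -> lam != 1 ->
  exists2 A, 0 < A & forall q mu : R, r <= q ->
    A `^ lam * q `^ mu <= A * K * q `^ (mu + e).
Proof.
move=> K0 e0 r_gt0 lam1; have Kr : 0 < K * r `^ e by rewrite mulr_gt0 ?powR_gt0.
pose A := (K * r `^ e) `^ ((lam - 1)^-1).
have A0 : 0 < A by rewrite powR_gt0.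
exists A => // q mu rq; have q0 : 0 < q := lt_le_trans r_gt0 rq.
have -> : A `^ lam = A * (K * r `^ e).
  rewrite -[X in _ = _ * X](powRr1 (ltW Kr)) -(@mulVf _ (lam - 1)) ?subr_eq0//.
  rewrite powRrM -/A -{2}(powRr1 (ltW A0)) -powRD ?(gt_eqF A0) ?implybT//.
  by congr (_ `^ _); ring.
rewrite powRD ?(gt_eqF q0) ?implybT//.
have -> : A * (K * r `^ e) * q `^ mu = A * K * (q `^ mu * r `^ e) by ring.
rewrite ler_wpM2l ?mulr_ge0 ?(ltW A0) ?(ltW K0)// ler_wpM2l ?powR_ge0//.
by rewrite ge0_ler_powR ?nnegrE// ltW.
Qed.

(** For v = A |x|^(2 a) and s = |x|^2 the two sides scale like s^(a lam) and s^(a - 2). The second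
    hypothesis orders these exponents, the third makes the right side positive, and the amplitude
    settles the constants down to s = r0^2. *)
Lemma pure_power_solution (n : nat) lam r0 a : 0 < r0 -> lam != 1 ->
  2 <= a * (1 - lam) ->
  2 * a * (2 * a + n%:R - 2) * (2 * a - 2) * (2 * a + n%:R - 4) < 0 ->
  exists v : 'rV[R]_n -> R, C4_positive_solution lam (~` eball0 (n := n) r0) v.
Proof.
move=> r0_gt0 lam1 ha; set K := _ * (_ - 4) => K0.
have r2 : 0 < r0 ^+ 2 by rewrite exprn_gt0.
have [||A A0 hA] := @amplitude_exists lam (- K) (a * (1 - lam) - 2) (r0 ^+ 2) _ _ r2 lam1.
- by rewrite oppr_gt0.
- by rewrite subr_ge0.
apply: (@radial_profile_solution _ n lam r0 0 A a) => // q r0q;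
  have q0 := lt_le_trans r2 r0q; rewrite mul0r add0r.
  by rewrite mulr_gt0 ?powR_gt0.
rewrite powRM ?powR_ge0 ?(ltW A0)// -powRrM -/K -mulNr -mulrN.
have := hA q (a * lam) r0q.
by have -> : a * lam + (a * (1 - lam) - 2) = a - 2 by ring.
Qed.

(* In the plane [|x|^(2 a)] has positive bilaplacian, so the solution is
   [A (B |x|^2 - |x|^(2 a))], the biharmonic term ensuring positivity. *)
Lemma planar_solution lam r0 : 0 < r0 -> lam < -1 ->
  exists v : 'rV[R]_2 -> R, C4_positive_solution lam (~` eball0 (n := 2) r0) v.
Proof.
move=> r0_gt0 lamN1.
(* Any [a] in [1 / 2, 1) with a - 2 >= lam serves; it exists because 2 + lam < 1. As lam < 0, v >= A
   |x|^2 gives v^lam <= (A |x|^2)^lam. *)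
pose a := (Num.max 2^-1 (2 + lam) + 1) / 2.
have m1 : Num.max 2^-1 (2 + lam) < 1 by rewrite gt_max; apply/andP; split; lra.
have m2 : 2^-1 <= Num.max 2^-1 (2 + lam) by rewrite le_max lexx.
have m3 : 2 + lam <= Num.max 2^-1 (2 + lam) by rewrite le_max lexx orbT.
have a1 : a < 1 by rewrite /a; lra.
have a2 : 2^-1 <= a by rewrite /a; lra.
have a3 : 2 + lam <= a by rewrite /a; lra.
pose K := 2 * a * (2 * a) * ((2 - 2 * a) * (2 - 2 * a)).
have K0 : 0 < K by rewrite /K !mulr_gt0//; lra.
have r2 : 0 < r0 ^+ 2 by rewrite exprn_gt0.
have lam1 : lam != 1 by apply/eqP; lra.
have e0 : 0 <= a - 2 - lam by lra.
have [A A0 hA] := amplitude_exists K0 e0 r2 lam1.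
(* As a < 1, s^a <= (r0^2)^(a - 1) s for s >= r0^2; the extra 1 leaves v >= A s. *)
pose B := 1 + (r0 ^+ 2) `^ (a - 1).
have vge q : r0 ^+ 2 <= q -> A * q <= A * B * q + - A * q `^ a.
  move=> r0q; have q0 := lt_le_trans r2 r0q.
  have -> : q `^ a = q * q `^ (a - 1).
    rewrite -{2}(powRr1 (ltW q0)) -powRD ?(gt_eqF q0) ?implybT//.
    by congr (_ `^ _); ring.
  have := @le0_ler_powR _ (r0 ^+ 2) q (a - 1) _ r2 r0q.
  rewrite subr_le0 (ltW a1) => /(_ isT) h.
  have := ler_wpM2l (ltW (mulr_gt0 A0 q0)) h; rewrite /B; lra.
apply: (@radial_profile_solution _ 2 lam r0 (A * B) (- A) a) => // q r0q;
  have q0 := lt_le_trans r2 r0q.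
  by apply: lt_le_trans (vge q r0q); rewrite mulr_gt0.
apply: (@le_trans _ _ ((A * q) `^ lam)).
  by apply: le0_ler_powR; [lra|rewrite mulr_gt0|exact: vge].
rewrite powRM ?(ltW A0) ?(ltW q0)//.
have := hA q lam r0q; have -> : lam + (a - 2 - lam) = a - 2 by ring.
by rewrite /K => /le_trans; apply; rewrite le_eqVlt; apply/orP; left; apply/eqP; ring.
Qed.

(** The power |x|^(b + 1) has 3 / 2 <= b + 1 < 2, so exactly one of the four factors, 2 a - 2, is
    negative when n >= 3. Since lam < -1 means 2 / (1 - lam) < 1, the value a = (b + 1) / 2 >= b can
    also meet 2 <= a (1 - lam). *)
Lemma sublinear_solution (n : nat) lam r0 : (3 <= n)%N -> 0 < r0 -> lam < -1 ->
  exists v : 'rV[R]_n -> R, C4_positive_solution lam (~` eball0 (n := n) r0) v.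
Proof.
move=> n3 r0_gt0 lamN1; have nR : 3 <= n%:R :> R by rewrite ler_nat.
have l2 : 2 / (1 - lam) < 1 by rewrite ltr_pdivrMr; lra.
pose b := Num.max 2^-1 (2 / (1 - lam)).
have b1 : b < 1 by rewrite gt_max l2 andbT; lra.
have b2 : 2^-1 <= b by rewrite le_max lexx.
have b3 : 2 / (1 - lam) <= b by rewrite le_max lexx orbT.
apply: (@pure_power_solution n lam r0 ((b + 1) / 2)) => //.
- by apply/eqP; lra.
- rewrite -ler_pdivrMr; lra.
have -> : 2 * ((b + 1) / 2) = b + 1 by field.
set P := _ * _; have -> : P = - ((b + 1) * (b + 1 + n%:R - 2) * (1 - b) * (b + 1 + n%:R - 4)).
  by rewrite /P; ring.
by rewrite oppr_lt0 !mulr_gt0//; lra.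
Qed.

(** The decaying power |x|^(-2 c) has the right sign when c > 0 and n - 4 < 2 c < n - 2. The scaling
    condition asks for c >= 2 / (lam - 1), and this is compatible with 2 c < n - 2 because lam > 1 +
    4 / (n - 2); the midpoint gives strict inequalities. *)
Lemma superlinear_solution (n : nat) lam r0 : (3 <= n)%N -> 0 < r0 ->
  1 + 4 / (n%:R - 2) < lam ->
  exists v : 'rV[R]_n -> R, C4_positive_solution lam (~` eball0 (n := n) r0) v.
Proof.
move=> n3 r0_gt0 lam_gt; have nR : 3 <= n%:R :> R by rewrite ler_nat.
have n4 : 0 < 4 / (n%:R - 2) :> R by rewrite divr_gt0//; lra.
have l1 : 0 < lam - 1 by lra.
have l2 : 2 / (lam - 1) < (n%:R - 2) / 2.
  rewrite ltr_pdivrMr//.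
  have : 4 / (n%:R - 2) < lam - 1 by lra.
  rewrite ltr_pdivrMr; last lra.
  lra.
have l0 : 0 < 2 / (lam - 1) by rewrite divr_gt0.
pose b := Num.max ((n%:R - 4) / 2) (2 / (lam - 1)).
have b1 : b < (n%:R - 2) / 2 by rewrite gt_max l2 andbT; lra.
have b2 : (n%:R - 4) / 2 <= b by rewrite le_max lexx.
have b3 : 2 / (lam - 1) <= b by rewrite le_max lexx orbT.
pose c := (b + (n%:R - 2) / 2) / 2.
apply: (@pure_power_solution n lam r0 (- c)) => //.
- by apply/eqP; lra.
- have -> : - c * (1 - lam) = c * (lam - 1) by ring.
  by rewrite -ler_pdivrMr// /c; lra.
have c1 : b < c by rewrite /c; lra.
have c2 : c < (n%:R - 2) / 2 by rewrite /c; lra.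
have -> : 2 * - c * (2 * - c + n%:R - 2) * (2 * - c - 2) * (2 * - c + n%:R - 4) =
  - (2 * c * (n%:R - 2 - 2 * c) * (2 + 2 * c) * (2 * c - (n%:R - 4))) by ring.
by rewrite oppr_lt0 !mulr_gt0//; lra.
Qed.

End Existence.

(** The bound on [lam] is multiplied by n - 2 so as to include n = 2, where the conclusion 4 < 0 is
    absurd and only lam < -1 survives. *)
Lemma positive_solution_exponent (R : realType) (n : nat) (lam r0 : R) :
  (2 <= n)%N -> 0 < r0 ->
  (exists v : 'rV[R]_n -> R, C4_positive_solution lam (~` eball0 (n := n) r0) v) ->
  -1 <= lam -> (n%:R - 2) + 4 < (n%:R - 2) * lam.
Proof.
move=> n2 r0_gt0 [v [[U [oU AU Cv]] v_gt0 v_ineq]] lamN1; rewrite ltNge; apply/negP => mlam.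
have far x : r0 ^+ 2 <= sqnorm x -> (~` eball0 (n := n) r0) x.
  by move=> xr; rewrite /setC/= /eball0/= enorm_lt//; apply/negP; rewrite -leNgt.
have [I meanI] := @is_mean_exists R n.
apply: (positive_solution_absurd meanI n2 r0_gt0 oU Cv _ _ _ lamN1 mlam).
- by move=> x /far/AU.
- by move=> x /far/v_gt0.
- by move=> x /far/v_ineq h; rewrite -oppr_ge0 (le_trans (powR_ge0 _ _) h).
- by move=> x /far/v_ineq.
Qed.

Unset Implicit Arguments.

Theorem corollary1p1 (R : realType) (lambda r0 : R) (n : nat)
    (hr0 : 0 < r0) (hn : (2 <= n)%N) :
  (n = 2%N ->
     ((exists v : 'rV[R]_n -> R,
         C4_positive_solution lambda (~` eball0 (n := n) r0) v) <->
      lambda < -1)) /\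
  ((3 <= n)%N ->
     ((exists v : 'rV[R]_n -> R,
         C4_positive_solution lambda (~` eball0 (n := n) r0) v) <->
      (lambda < -1 \/ 1 + 4 / (n%:R - 2) < lambda))).
Proof.
split=> [n_eq2|n3]; split.
- move=> /(positive_solution_exponent hn hr0) h; rewrite ltNge; apply/negP => /h.
  by rewrite n_eq2 subrr mul0r add0r ltNge ler0n.
- by subst n; exact: planar_solution.
- move=> /(positive_solution_exponent hn hr0) h; have [?|/h lam] := ltP lambda (-1); [by left|right].
  have nR : 0 < n%:R - 2 :> R by rewrite subr_gt0 ltr_nat.
  have -> : 1 + 4 / (n%:R - 2) = ((n%:R - 2) + 4) / (n%:R - 2) :> R by field; lra.
  by rewrite ltr_pdivrMr// mulrC.
- by move=> [|]; [exact: sublinear_solution|exact: superlinear_solution].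
Qed.
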